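(* Let $\theta\in[0,1]$, let $N>1$ be any integer, let $0=t_0<t_1<\dots<t_N=T$ be an arbitrary time grid, and let $f$ be a body force for which the right-hand side below is defined and finite. Let $\{(w_n^h,q_n^h)\}_{n=0}^N\subset X^h\times Q^h$ be a solution of the fully discrete variable-step DLN scheme for the corrected Smagorinsky model: for every $1\le n\le N-1$, $$\Big(\tfrac{\alpha_2 w_{n+1}^h+\alpha_1 w_n^h+\alpha_0 w_{n-1}^h}{\widehat k_n},v^h\Big)+\tfrac{C_s^4\delta^2}{\mu^2}\Big(\tfrac{\alpha_2\nabla w_{n+1}^h+\alpha_1\nabla w_n^h+\alpha_0\nabla w_{n-1}^h}{\widehat k_n},\nabla v^h\Big)+\nu(\nabla w_{n,\beta}^h,\nabla v^h)+b^*(w_{n,\beta}^h,w_{n,\beta}^h,v^h)$$ $$+\gamma(\nabla\cdot w_{n,\beta}^h,\nabla\cdot v^h)-(q_{n,\beta}^h,\nabla\cdot v^h)+\big((C_s\delta)^2|\nabla w_{n,\beta}^h|\nabla w_{n,\beta}^h,\nabla v^h\big)=(f_{n,\beta},v^h)\quad\forall v^h\in X^h,$$ $$(\nabla\cdot w_{n,\beta}^h,p^h)=0\quad\forall p^h\in Q^h.$$ Then the scheme is unconditionally, long-time stable, i.e. there is a constant $C(\theta)>0$ depending only on $\theta$ such that, with no restriction on the time steps, $$\frac{1+\theta}{4}\Big(\|w_N^h\|^2+\frac{C_s^4\delta^2}{\mu^2}\|\nabla w_N^h\|^2\Big)+\frac{1-\theta}{4}\Big(\|w_{N-1}^h\|^2+\frac{C_s^4\delta^2}{\mu^2}\|\nabla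 w_{N-1}^h\|^2\Big)$$ $$+\sum_{n=1}^{N-1}\Big(\Big\|\sum_{\ell=0}^2\lambda_\ell^{(n)}w_{n-1+\ell}^h\Big\|^2+\frac{C_s^4\delta^2}{\mu^2}\Big\|\sum_{\ell=0}^2\lambda_\ell^{(n)}\nabla w_{n-1+\ell}^h\Big\|^2\Big)+\sum_{n=1}^{N-1}\widehat k_n\Big(\frac{\nu}{2}\|\nabla w_{n,\beta}^h\|^2+\gamma\|\nabla\cdot w_{n,\beta}^h\|^2\Big)$$ $$+\sum_{n=1}^{N-1}\widehat k_n\int_\Omega\big[(C_s\delta)^2|\nabla w_{n,\beta}^h|\big]|\nabla w_{n,\beta}^h|^2\,dx$$ $$\le\frac{C(\theta)k_{\max}^4}{\nu}\|f_{tt}\|_{L^2(0,T;X')}^2+\frac1\nu\,\||f|\|_{2,-1,2,\beta}^2+\frac{1+\theta}{4}\Big(\|w_1^h\|^2+\frac{C_s^4\delta^2}{\mu^2}\|\nabla w_1^h\|^2\Big)+\frac{1-\theta}{4}\Big(\|w_0^h\|^2+\frac{C_s^4\delta^2}{\mu^2}\|\nabla w_0^h\|^2\Big).$$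
   Context: $\Omega\subset\mathbb R^d$ ($d=2,3$) is a bounded regular domain; $\|\cdot\|$ and $(\cdot,\cdot)$ are the $L^2(\Omega)$ norm and inner product; $|\cdot|$ is the Euclidean norm. The constants $\nu,\mu,C_s,\delta,\gamma$ are positive. Spaces: $X=\{v\in (L^3(\Omega))^d:\nabla v\in (L^3(\Omega))^{d\times d},\ v|_{\partial\Omega}=0\}$, $Q=\{q\in L^2(\Omega):\int_\Omega q\,dx=0\}$; $X^h\subset X$ and $Q^h\subset Q$ are finite element spaces. $X'$ is the dual of $X$ with norm $\|f\|_{-1}=\sup_{0\ne v\in X}(f,v)/\|\nabla v\|$. The trilinear form is $b^*(u,v,w)=\frac12(u\cdot\nabla v,w)-\frac12(u\cdot\nabla w,v)$. Time grid: $k_n=t_{n+1}-t_n$, $k_{\max}=\max_{0\le n\le N-1}k_n$, $\varepsilon_n=(k_n-k_{n-1})/(k_n+k_{n-1})\in(-1,1)$. DLN coefficients: $\alpha_2=\frac12(\theta+1)$, $\alpha_1=-\theta$, $\alpha_0=\frac12(\theta-1)$, and $$\beta_2^{(n)}=\tfrac14\Big(1+\tfrac{1-\theta^2}{(1+\varepsilon_n\theta)^2}+\varepsilon_n^2\tfrac{\theta(1-\theta^2)}{(1+\varepsilon_n\theta)^2}+\theta\Big),\quad \beta_1^{(n)}=\tfrac12\Big(1-\tfrac{1-\theta^2}{(1+\varepsilon_n\theta)^2}\Big),$$ $$\beta_0^{(n)}=\tfrac14\Big(1+\tfrac{1-\theta^2}{(1+\varepsilon_n\theta)^2}-\varepsilon_n^2\tfrac{\theta(1-\theta^2)}{(1+\varepsilon_n\theta)^2}-\theta\Big).$$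 $\widehat k_n=\alpha_2k_n-\alpha_0k_{n-1}$. Further $$\lambda_1^{(n)}=-\frac{\sqrt{\theta(1-\theta^2)}}{\sqrt2(1+\varepsilon_n\theta)},\quad\lambda_2^{(n)}=-\frac{1-\varepsilon_n}{2}\lambda_1^{(n)},\quad\lambda_0^{(n)}=-\frac{1+\varepsilon_n}{2}\lambda_1^{(n)}.$$ Notation: $t_{n,\beta}=\sum_{\ell=0}^2\beta_\ell^{(n)}t_{n-1+\ell}$, $w_{n,\beta}^h=\sum_{\ell=0}^2\beta_\ell^{(n)}w_{n-1+\ell}^h$, $q_{n,\beta}^h=\sum_{\ell=0}^2\beta_\ell^{(n)}q_{n-1+\ell}^h$, $f_{n,\beta}=\sum_{\ell=0}^2\beta_\ell^{(n)}f(t_{n-1+\ell})$, and $$\||f|\|_{2,-1,2,\beta}=\Big(\sum_{n=1}^{N-1}(k_n+k_{n-1})\|f(\cdot,t_{n,\beta})\|_{-1}^2\Big)^{1/2}.$$ *)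

(* Defs.v *)
From HB Require Import structures.
From mathcomp Require Import all_boot all_order all_algebra.
From mathcomp Require Import all_classical all_reals all_analysis.
Set Implicit Arguments.
Unset Strict Implicit.
Unset Printing Implicit Defensive.
Import Order.TTheory GRing.Theory Num.Theory.
Import numFieldNormedType.Exports.
Local Open Scope classical_set_scope.
Local Open Scope ring_scope.

(* Lebesgue measure on R^d: Caratheodory restriction of the outer measure
   inf { sum_k vol B_k | X included in the union of the boxes B_k }.
   [None] stands for the empty set, so that finite covers are allowed (and the
   outer measure of the empty set is 0 even when [d = 0]). *)
Section lebesgue_Rd.
Variables (R : realType) (d : nat).
Local Open Scope ereal_scope.

Definition box (B : option ('rV[R]_d * 'rV[R]_d)) : set 'rV[R]_d :=
  if B is Some (a, b) then [set x | forall i, (a 0 i <= x 0 i <= b 0 i)%R]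
  else set0.

Definition box_vol (B : option ('rV[R]_d * 'rV[R]_d)) : \bar R :=
  if B is Some (a, b) then (\prod_(i < d) Num.max 0 (b 0 i - a 0 i))%:E else 0.

Definition lebesgue_outer (X : set 'rV[R]_d) : \bar R :=
  ereal_inf [set \sum_(k <oo) box_vol (F k) | F in
    [set F : nat -> option ('rV[R]_d * 'rV[R]_d) |
      X `<=` \bigcup_k box (F k)]].

Lemma box_vol_ge0 B : 0 <= box_vol B.
Proof.
case: B => [[a b]|//] /=.
by rewrite lee_fin prodr_ge0// => i _; rewrite le_max lexx.
Qed.

Lemma lebesgue_outer_ge0 X : 0 <= lebesgue_outer X.
Proof.
apply: le_ereal_inf_tmp => _ [F _ <-].
by apply: nneseries_ge0 => n _ _; exact: box_vol_ge0.
Qed.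

Lemma lebesgue_outer0 : lebesgue_outer set0 = 0.
Proof.
apply/eqP; rewrite eq_le lebesgue_outer_ge0 andbT.
apply: ereal_inf_lbound; exists (fun=> None); first by [].
exact: eseries0.
Qed.

Lemma le_lebesgue_outer : {homo lebesgue_outer : A B / A `<=` B >-> A <= B}.
Proof.
move=> A B AB; apply: ereal_inf_le_tmp => _ [F BF <-].
by exists F => //; exact: subset_trans BF.
Qed.

Lemma lebesgue_outer_sigma_subadditive : sigma_subadditive lebesgue_outer.
Proof.
move=> A; have [[i ioo]|] := pselect (exists i, lebesgue_outer (A i) = +oo).
  rewrite (eseries_pinfty _ _ ioo) ?leey// => n _.
  by rewrite -ltNye (lt_le_trans _ (lebesgue_outer_ge0 _)).
rewrite -forallNE => Aoo.
suff add2e (e : {posnum R}) : lebesgue_outer (\bigcup_n A n) <=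
    \sum_(i <oo) lebesgue_outer (A i) + e%:num%:E.
  by apply/lee_addgt0Pr => _/posnumP[].
rewrite (le_trans _ (epsilon_trick _ _ _))//; last first.
  by move=> n; exact: lebesgue_outer_ge0.
pose P n (B : nat -> option ('rV[R]_d * 'rV[R]_d)) :=
  A n `<=` \bigcup_k box (B k) /\
  \sum_(k <oo) box_vol (B k) <=
    lebesgue_outer (A n) + (e%:num / (2 ^ n.+1)%:R)%:E.
have [G PG] : {G & forall n, P n (G n)}.
  apply: (@choice _ _ P) => n; rewrite /P /lebesgue_outer.
  set S := (X in ereal_inf X); move infS : (ereal_inf S) => iS.
  case: iS infS => [r Sr|Soo|Soo].
  - have en1 : (0 < e%:num / (2 ^ n.+1)%:R)%R by [].
    have /(lb_ereal_inf_adherent en1) : ereal_inf S \is a fin_num by rewrite Sr.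
    move=> [x [B AnB muBx] xS].
    by exists B; split => //; rewrite muBx -Sr; exact/ltW.
  - by have := Aoo n; rewrite /lebesgue_outer Soo.
  - suff : lbound S 0 by move/le_ereal_inf_tmp; rewrite Soo.
    move=> /= _ [B AnB <-]; apply: nneseries_ge0 => k _ _.
    exact: box_vol_ge0.
have muG_ge0 x : 0 <= (box_vol \o uncurry G) x by exact: box_vol_ge0.
apply: (@le_trans _ _ (\esum_(i in setT) (box_vol \o uncurry G) i)).
  apply: ereal_inf_lbound => /=.
  have /card_esym/ppcard_eqP[f] := card_nat2.
  exists (uncurry G \o f) => /=.
    apply: (@subset_trans _  (\bigcup_n \bigcup_k box (G n k))) => [t [i _]|].
      by move=> /(PG i).1 [j _ ?]; exists i => //; exists j.
    move=> t [i _ [j _ Bijt]]; exists (f^-1%FUN (i, j)) => //=.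
    by rewrite invK ?inE.
  rewrite -(esum_pred_image (box_vol \o uncurry G) _ xpredT) ?[fun=> _]set_true//.
  by rewrite image_eq.
rewrite (_ : esum _ _ = \sum_(i <oo) \sum_(j <oo ) box_vol (G i j)); last first.
  pose J : nat -> set (nat * nat) := fun i => [set (i, j) | j in setT].
  rewrite (_ : setT = \bigcup_k J k); last first.
    by rewrite predeqE => -[a b]; split => // _; exists a => //; exists b.
  rewrite esum_bigcupT /=; last 2 first.
    - apply/trivIsetP => i j _ _ ij.
      rewrite predeqE => -[n m] /=; split => //= -[] [_] _ [<-{n} _].
      by move=> [m' _] [] /esym/eqP; rewrite (negbTE ij).
    - by move=> /= [n m]; exact: box_vol_ge0.
  rewrite -(image_id [set: nat]) -fun_true esum_pred_image//; last first.
    by move=> n _; apply: esum_ge0 => i _; exact: box_vol_ge0.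
  apply: eq_eseriesr => /= j _.
  rewrite -(esum_pred_image (box_vol \o uncurry G) (pair j) predT)/=; last 2 first.
    - by move=> ? _; exact: box_vol_ge0.
    - by move=> ? ? _ _; exact: (@can_inj _ _ _ snd).
  by congr esum; rewrite predeqE => -[a b]; split; move=> [i _ <-]; exists i.
apply: lee_lim.
- apply: is_cvg_nneseries => n *.
  by apply: nneseries_ge0 => m *; exact: (muG_ge0 (n, m)).
- by apply: is_cvg_nneseries => n *; apply: adde_ge0 => //; exact: lebesgue_outer_ge0.
- by near=> n; apply: lee_sum => i _; exact: (PG i).2.
Unshelve. all: by end_near. Qed.

HB.instance Definition _ := isOuterMeasure.Build R 'rV[R]_d lebesgue_outer
  lebesgue_outer0 lebesgue_outer_ge0 le_lebesgue_outer
  lebesgue_outer_sigma_subadditive.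

Let outer : {outer_measure set 'rV[R]_d -> \bar R} := lebesgue_outer.

Definition Rd := caratheodory_type outer.

Definition leb : {measure set Rd -> \bar R} :=
  (outer : set (caratheodory_type outer) -> \bar R).

End lebesgue_Rd.
Arguments leb {R d}.

Section function_spaces.
Variables (R : realType) (d : nat).
Implicit Types (Omega : set 'rV[R]_d) (phi : 'rV[R]_d -> R).

Definition mdot m n (A B : 'M[R]_(m, n)) : R := \sum_i \sum_j A i j * B i j.
Definition enorm m n (A : 'M[R]_(m, n)) : R := Num.sqrt (mdot A A).

(* Near each boundary point, Omega is the part lying below the graph of a
   Lipschitz function over the hyperplane orthogonal to a unit vector [e]; the
   function is extended to R^d by invariance along [e]. *)
Definition lipschitz_boundary Omega :=
  forall x, closure Omega x -> ~ Omega x ->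
  exists (e : 'rV[R]_d) (g : 'rV[R]_d -> R) (L : R),
    [/\ enorm e = 1,
        forall y s, g (y + s *: e) = g y,
        forall y z, `|g y - g z| <= L * enorm (y - z) &
        \forall y \near x, Omega y <-> g y < mdot y e].

Definition regular_domain Omega :=
  [/\ Omega !=set0, open Omega, connected Omega, bounded_set Omega &
      lipschitz_boundary Omega].

Fixpoint iter_partial (s : seq 'I_d) phi : 'rV[R]_d -> R :=
  if s is i :: s' then fun x => 'D_(delta_mx 0 i) (iter_partial s' phi) x
  else phi.

Definition smooth phi := forall s : seq 'I_d,
  continuous (iter_partial s phi) /\
  forall i x, derivable (iter_partial s phi) x (delta_mx 0 i).

Definition test_function Omega phi :=
  smooth phi /\
  exists K, [/\ compact K, K `<=` Omega & forall x, ~ K x -> phi x = 0].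

Definition Lp Omega (p : nat) (u : 'rV[R]_d -> R) :=
  measurable_fun (Omega : set (Rd R d)) (u : Rd R d -> R) /\
  leb.-integrable (Omega : set (Rd R d)) (fun x => (`|u x| ^+ p)%:E).

Definition LpM Omega (p m n : nat) (U : 'rV[R]_d -> 'M[R]_(m, n)) :=
  forall i j, Lp Omega p (fun x => U x i j).

Definition inner Omega m n (U V : 'rV[R]_d -> 'M[R]_(m, n)) : R :=
  \int[leb]_(x in (Omega : set (Rd R d))) mdot (U x) (V x).

Definition inner0 Omega (p q : 'rV[R]_d -> R) : R :=
  \int[leb]_(x in (Omega : set (Rd R d))) (p x * q x).

Definition l2norm Omega m n (U : 'rV[R]_d -> 'M[R]_(m, n)) : R :=
  Num.sqrt (inner Omega U U).

Definition l2norm0 Omega (p : 'rV[R]_d -> R) : R := Num.sqrt (inner0 Omega p p).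

(* A Sobolev vector field is carried together with its weak gradient:
   [u.1 = v] and [u.2 = grad v], where (grad v) i j = d v_j / d x_i. *)
Definition field_grad : Type :=
  (('rV[R]_d -> 'rV[R]_d) * ('rV[R]_d -> 'M[R]_d))%type.

Definition classical_grad (v : 'rV[R]_d -> 'rV[R]_d) (x : 'rV[R]_d) : 'M[R]_d :=
  \matrix_(i, j) 'D_(delta_mx 0 i) (fun y => v y 0 j) x.

Definition weak_gradient Omega (u : field_grad) :=
  forall phi, test_function Omega phi -> forall i j,
    inner0 Omega (fun x => u.1 x 0 j) (fun x => 'D_(delta_mx 0 i) phi x) =
    - inner0 Omega (fun x => u.2 x i j) phi.

(* Zero trace on the boundary: W^{1,3}-limit of compactly supported smooth
   fields. *)
Definition zero_trace Omega (u : field_grad) :=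
  exists phi : nat -> 'rV[R]_d -> 'rV[R]_d,
    [/\ forall k j, test_function Omega (fun x => phi k x 0 j),
        (\int[leb]_(x in (Omega : set (Rd R d)))
           (enorm (phi k x - u.1 x) ^+ 3)%:E)%E @[k --> \oo] --> 0%E &
        (\int[leb]_(x in (Omega : set (Rd R d)))
           (enorm (classical_grad (phi k) x - u.2 x) ^+ 3)%:E)%E
             @[k --> \oo] --> 0%E].

Definition spaceX Omega : set field_grad :=
  [set u | [/\ LpM Omega 3 u.1, LpM Omega 3 u.2, weak_gradient Omega u &
               zero_trace Omega u]].

Definition spaceQ Omega : set ('rV[R]_d -> R^o) :=
  [set q | Lp Omega 2 q /\ \int[leb]_(x in (Omega : set (Rd R d))) q x = 0].

Definition findim_subspace (V : lmodType R) (A : set V) :=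
  [/\ A 0, forall a u v, A u -> A v -> A (a *: u + v) &
      exists (m : nat) (b : 'I_m -> V),
        forall u, A u -> exists c : 'I_m -> R, u = \sum_i c i *: b i].

Definition div (u : field_grad) (x : 'rV[R]_d) : R := \tr (u.2 x).

(* (u . grad v)_j = sum_i u_i d_i v_j *)
Definition convect (u v : field_grad) (x : 'rV[R]_d) : 'rV[R]_d :=
  u.1 x *m v.2 x.

Definition bstar Omega (u v w : field_grad) : R :=
  2^-1 * inner Omega (convect u v) w.1 - 2^-1 * inner Omega (convect u w) v.1.

Definition functional : Type := ('rV[R]_d -> 'rV[R]_d) -> R^o.

Definition dualX Omega : set functional :=
  [set F | (forall a u v, spaceX Omega u -> spaceX Omega v ->
              F (a *: u.1 + v.1) = a * F u.1 + F v.1) /\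
           exists M : R, forall u, spaceX Omega u ->
              `|F u.1| <= M * l2norm Omega u.2].

(* By the Poincare inequality, u in X is nonzero (as a class of a.e. equal
   functions) if and only if the L^2 norm of its gradient is nonzero. *)
Definition dual_norm Omega (F : functional) : R :=
  sup [set F u.1 / l2norm Omega u.2 | u in
         [set u | spaceX Omega u /\ l2norm Omega u.2 != 0]].

Definition simple_dual Omega (s : R -> functional) :=
  exists (m : nat) (A : 'I_m -> set R) (F : 'I_m -> functional),
    [/\ forall i, measurable (A i), forall i, dualX Omega (F i) &
        forall r, s r = \sum_i \1_(A i) r *: F i].

Definition strongly_measurable Omega (D : set R) (g : R -> functional) :=
  exists s : nat -> R -> functional,
    (forall n, simple_dual Omega (s n)) /\
    forall r, D r -> dual_norm Omega (s n r - g r) @[n --> \oo] --> 0.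

Definition L2X' Omega (T : R) (g : R -> functional) :=
  [/\ forall r, `]0, T[%classic r -> dualX Omega (g r),
      strongly_measurable Omega `]0, T[ g &
      (\int[lebesgue_measure]_(r in `]0%R, T[)
         (dual_norm Omega (g r) ^+ 2)%:E < +oo)%E].

Definition L2X'_norm Omega (T : R) (g : R -> functional) : R :=
  Num.sqrt (\int[lebesgue_measure]_(r in `]0, T[) (dual_norm Omega (g r) ^+ 2)).

Definition time_test_function (T : R) (phi : R -> R) :=
  (forall n x, derivable (derive1n n phi) x 1) /\
  exists K, [/\ compact K, K `<=` `]0, T[ & forall x, ~ K x -> phi x = 0].

(* The X'-valued identity int f phi'' = int g phi, tested against X. *)
Definition weak_second_time_derivative Omega (T : R) (f g : R -> functional) :=
  forall phi : R -> R, time_test_function T phi -> forall u, spaceX Omega u ->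
    \int[lebesgue_measure]_(r in `]0, T[) (f r u.1 * derive1n 2 phi r) =
    \int[lebesgue_measure]_(r in `]0, T[) (g r u.1 * phi r).

(* [f] is the representative that is continuous on [0, T], so that its point
   values are meaningful, and [ftt] is its second time derivative. *)
Definition body_force Omega (T : R) (f ftt : R -> functional) :=
  [/\ forall r, `[0, T]%classic r -> dualX Omega (f r),
      forall r, `[0, T]%classic r ->
        dual_norm Omega (f s - f r) @[s --> within `[0, T] (nbhs r)] --> 0,
      L2X' Omega T ftt &
      weak_second_time_derivative Omega T f ftt].

End function_spaces.

Section dln.
Variable R : realType.
Implicit Types (theta eps : R) (t : nat -> R^o) (n l : nat).

Definition time_grid t (N : nat) (T : R) :=
  [/\ t 0%N = 0, forall n, (n < N)%N -> t n < t n.+1 & t N = T].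

Definition step t n : R := t n.+1 - t n.

Definition step_max t (N : nat) : R := \big[Num.max/0]_(0 <= n < N) step t n.

Definition eps_ t n : R :=
  (step t n - step t n.-1) / (step t n + step t n.-1).

Definition dln_alpha theta l : R :=
  match l with
  | 0 => 2^-1 * (theta - 1)
  | 1 => - theta
  | _ => 2^-1 * (theta + 1)
  end.

Definition dln_beta theta eps l : R :=
  let r := (1 - theta ^+ 2) / (1 + eps * theta) ^+ 2 in
  let s := eps ^+ 2 * (theta * (1 - theta ^+ 2) / (1 + eps * theta) ^+ 2) in
  match l with
  | 0 => 4^-1 * (1 + r - s - theta)
  | 1 => 2^-1 * (1 - r)
  | _ => 4^-1 * (1 + r + s + theta)
  end.

Definition dln_lambda theta eps l : R :=
  let l1 := - (Num.sqrt (theta * (1 - theta ^+ 2)) /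
               (Num.sqrt 2 * (1 + eps * theta))) in
  match l with
  | 0 => - ((1 + eps) / 2) * l1
  | 1 => l1
  | _ => - ((1 - eps) / 2) * l1
  end.

Definition khat theta t n : R :=
  dln_alpha theta 2 * step t n - dln_alpha theta 0 * step t n.-1.

(* sum_{l=0}^2 c_l w_{n-1+l}, for n >= 1 *)
Definition stencil (V : lmodType R) (c : nat -> R) (w : nat -> V) n : V :=
  \sum_(l < 3) c l *: w (n.-1 + l)%N.

Definition beta_avg (V : lmodType R) theta t (w : nat -> V) n : V :=
  stencil (dln_beta theta (eps_ t n)) w n.

Definition triple_norm d (Omega : set 'rV[R]_d) theta t (N : nat)
    (f : R -> functional R d) : R :=
  Num.sqrt (\sum_(1 <= n < N) (step t n + step t n.-1) *
              dual_norm Omega (f (beta_avg theta t t n)) ^+ 2).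

Definition dln_momentum d (Omega : set 'rV[R]_d) (Xh : set (field_grad R d))
    theta (nu mu Cs delta gamma : R) t (f : R -> functional R d)
    (w : nat -> field_grad R d) (q : nat -> 'rV[R]_d -> R^o) n :=
  let kh := khat theta t n in
  let dw := stencil (dln_alpha theta) w n in
  let wb := beta_avg theta t w n in
  let qb := beta_avg theta t q n in
  let fb := beta_avg theta t (f \o t) n in
  forall v, Xh v ->
    inner Omega (fun x => kh^-1 *: dw.1 x) v.1
    + Cs ^+ 4 * delta ^+ 2 / mu ^+ 2
        * inner Omega (fun x => kh^-1 *: dw.2 x) v.2
    + nu * inner Omega wb.2 v.2
    + bstar Omega wb wb v
    + gamma * inner0 Omega (div wb) (div v)
    - inner0 Omega qb (div v)
    + inner Omega (fun x => ((Cs * delta) ^+ 2 * enorm (wb.2 x)) *: wb.2 x) v.2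
    = fb v.1.

Definition dln_continuity d (Omega : set 'rV[R]_d)
    (Qh : set ('rV[R]_d -> R^o)) theta t (w : nat -> field_grad R d) n :=
  forall p, Qh p -> inner0 Omega (div (beta_avg theta t w n)) p = 0.

End dln.

(* Main.v *)
(* Testing the scheme with [v = w_{n,beta}] kills the convective term, by skew
   symmetry, and the pressure term, by the discrete continuity equation.  The DLN
   coefficients satisfy a pointwise algebraic identity (G-stability) that turns the
   product of the alpha- and beta-combinations into a telescoping energy plus the
   square of the lambda-combination, so only the forcing term
   [f_{n,beta}(w_{n,beta})] has to be estimated.  Replacing [f_{n,beta}] by
   [f(t_{n,beta})] costs a second difference of [f], because the beta weights sum to
   1 and [t_{n,beta}] is the corresponding average of the nodes.  Testing the
   X'-valued equation [f'' = f_tt] against a mollified Peano kernel bounds this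
   difference by the step times the integral of [|f_tt|_{-1}] over
   [[t_{n-1}, t_{n+1}]]; Young's and the Cauchy-Schwarz inequalities and a
   summation over [n] conclude. *)
Require Import Defs.
From mathcomp Require Import all_boot all_order all_algebra.
From mathcomp Require Import all_classical all_reals all_analysis.
From mathcomp Require Import measurable_realfun ring lra.
Set Implicit Arguments.
Unset Strict Implicit.
Unset Printing Implicit Defensive.
Import Order.TTheory GRing.Theory Num.Theory.
Import numFieldNormedType.Exports.
Local Open Scope classical_set_scope.
Local Open Scope ring_scope.

(** * Lebesgue measure on R^d *)

(** No vector-valued integral enters: for a fixed [u] in X the force is read through the scalar
    function [f r u.1] of [r], continuous on [0, T], whose weak second derivative [ftt r u.1] is at
    most the dual norm of [ftt r] times the norm of the gradient of [u]. The resulting bound is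
    linear in that norm and is used at the beta average of [w]. The obstacle is the ends of the time
    interval: test functions have compact support in ]0, T[, whereas the first and last windows
    touch 0 and T. The kernel is therefore built on nodes moved inwards, and continuity of the force
    brings them back. Freedom from step restrictions rests on two facts: the weights of the
    telescoping energy do not involve the steps, and the beta weights are bounded in terms of
    [theta] alone because [eps > -1]. Young's inequality spends [nu / 2], hence the remaining
    [nu / 2] on the left and the factor [1 / nu] on the right. Expanding the inner products requires
    integrable products; these come from L^3 fields on a set of finite measure, and the
    measurability of an open set is obtained from the Caratheodory criterion. *)

Section lebesgue_Rd_measurability.
Variables (R : realType) (d : nat).

Local Notation obox := (option ('rV[R]_d * 'rV[R]_d)).

Definition box_cut_le (i : 'I_d) (c : R) (B : obox) : obox :=
  if B is Some (a, b) then
    Some (a, \row_j if j == i then Num.min (b 0 j) c else b 0 j)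
  else None.

Definition box_cut_ge (i : 'I_d) (c : R) (B : obox) : obox :=
  if B is Some (a, b) then
    Some (\row_j if j == i then Num.max (a 0 j) c else a 0 j, b)
  else None.

(** Only the [i]-th factor of the volume changes. The truncation at 0 makes the identity hold also
    when the hyperplane misses the box or the box is empty. *)
Lemma box_vol_cut i c (B : obox) :
  (box_vol (box_cut_le i c B) + box_vol (box_cut_ge i c B) = box_vol B)%E.
Proof.
case: B => [[a b]|] /=; last by rewrite adde0.
rewrite -EFinD; congr EFin.
rewrite !(bigD1 (P := predT) i) //= !mxE !eqxx.
under eq_bigr => j /negbTE ji do rewrite mxE ji.
under [X in _ + _ * X]eq_bigr => j /negbTE ji do rewrite mxE ji.
rewrite -mulrDl; congr (_ * _).
rewrite /Num.min /Num.max.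
by case: ifPn; case: ifPn; case: ifPn; case: ifPn; case: ifPn; lra.
Qed.

(** Caratheodory's criterion: each box of a cover of [X] is cut by the hyperplane, the two families
    of pieces cover the two parts of [X], and their volumes add up to the original ones. *)
Lemma measurable_halfspace i c :
  measurable ([set x : 'rV[R]_d | x 0 i <= c] : set (Rd R d)).
Proof.
apply: le_caratheodory_measurable => X.
rewrite [leRHS](_ : _ = lebesgue_outer X)//; apply: le_ereal_inf_tmp => _ [F XF <-].
rewrite -(eq_eseriesr (fun k _ => box_vol_cut i c (F k))).
rewrite nneseriesD; [|by move=> *; exact: box_vol_ge0..].
apply: leeD; apply: ereal_inf_lbound.
- exists (fun k => box_cut_le i c (F k)) => // x [Xx xc].
  have [k _ Fkx] := XF _ Xx; exists k => //; move: Fkx.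
  case: (F k) => [[a b]|] //= abx j; rewrite mxE.
  have /andP[-> xb] /= := abx j.
  by case: eqVneq => [ji|//]; rewrite le_min xb ji.
- exists (fun k => box_cut_ge i c (F k)) => // x [Xx xc].
  have [k _ Fkx] := XF _ Xx; exists k => //; move: Fkx.
  case: (F k) => [[a b]|] //= abx j; rewrite mxE.
  have /andP[ax ->] := abx j; rewrite andbT.
  case: eqVneq => [ji|//]; rewrite ge_max ax ji /=.
  by rewrite leNgt; apply/negP => /ltW.
Qed.

Lemma measurable_open_halfspace i c :
  measurable ([set x : 'rV[R]_d | c < x 0 i] : set (Rd R d)).
Proof.
rewrite (_ : mkset _ = ~` [set x : 'rV[R]_d | x 0 i <= c]).
  exact/measurableC/measurable_halfspace.
by apply/seteqP; split => x /=; rewrite ltNge => /negP.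
Qed.

(** Half-open, to be an intersection of the two kinds of half-spaces already known to be measurable;
    the rational centres and sizes 1/(k+1) make the family countable. *)
Definition rat_cube (p : 'rV[rat]_d * nat) : set 'rV[R]_d :=
  [set x | forall i, ratr (p.1 0 i) - p.2.+1%:R^-1 < x 0 i
                     <= ratr (p.1 0 i) + p.2.+1%:R^-1].

Lemma measurable_rat_cube p : measurable (rat_cube p : set (Rd R d)).
Proof.
rewrite (_ : rat_cube p = \bigcap_(i in [set: 'I_d])
   ([set x : 'rV[R]_d | ratr (p.1 0 i) - p.2.+1%:R^-1 < x 0 i]
    `&` [set x | x 0 i <= ratr (p.1 0 i) + p.2.+1%:R^-1])).
  apply: fin_bigcap_measurable => // i _; apply: measurableI.
    exact: measurable_open_halfspace.
  exact: measurable_halfspace.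
apply/seteqP; split => x /= h i; first by move=> _; split => /=; have /andP[] := h i.
by apply/andP; exact: h.
Qed.

Lemma open_measurable_Rd (U : set 'rV[R]_d) :
  open U -> measurable (U : set (Rd R d)).
Proof.
move=> oU.
pose F p := if `[< rat_cube p `<=` U >] then rat_cube p else set0.
suff -> : U = \bigcup_p F p.
  apply: countable_bigcupT_measurable; first exact: countableP.
  by move=> p; rewrite /F; case: ifP => // _; exact: measurable_rat_cube.
apply/seteqP; split => [x Ux|x [p _]]; last first.
  by rewrite /F; case: ifPn => // /asboolP; exact.
have /nbhs_ballP[e /= e0 xeU] : nbhs x U by exact: open_nbhs_nbhs.
(* The rational centre will lie within 1/(k+1) of [x] in each coordinate, so points of the cube are
   within 2/(k+1) < [e] of [x]. *)
have e20 : 0 < e / 2 by rewrite divr_gt0.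
have [k _ ke] := near_infty_natSinv_lt (PosNum e20).
have {ke} := ke k (leqnn _) => /= ke.
have k0 : 0 < k.+1%:R^-1 :> R by rewrite invr_gt0.
have qP i : exists q : rat, x 0 i - k.+1%:R^-1 < ratr q < x 0 i + k.+1%:R^-1.
  have /rat_in_itvoo[q] : x 0 i - k.+1%:R^-1 < x 0 i + k.+1%:R^-1.
    by rewrite ltrD2l gtrN.
  by rewrite in_itv /= => qx; exists q.
have [q qx] := choice qP.
exists (\row_i q i, k) => //; rewrite /F asboolT.
  move=> i /=; rewrite mxE; have := qx i.
  move: (x 0 i) (ratr _) (k.+1%:R^-1) => a b c /andP[? ?].
  by apply/andP; split; lra.
move=> y /= yq; apply: xeU; split => // i j; rewrite (ord1 i) /ball /=.
have := qx j; have := yq j; rewrite mxE /= ltr_norml; move: ke.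
move: (x 0 j) (y 0 j) (ratr _) (k.+1%:R^-1) => a b c h ? /andP[? ?] /andP[? ?].
by apply/andP; split; lra.
Qed.

Lemma leb_bounded_lty (U : set 'rV[R]_d) :
  bounded_set U -> (leb (U : set (Rd R d)) < +oo)%E.
Proof.
move=> [M [_ MU]].
have {MU} UM x : U x -> `|x| <= M + 1 by apply: MU; rewrite ltrDl.
(* A single box covers [U]; [None] pads the sequence at no cost in volume. *)
pose F k := if k == 0%N then Some (const_mx (- (M + 1)), const_mx (M + 1))
            else None : obox.
apply: (@le_lt_trans _ _ (\sum_(k <oo) box_vol (F k))%E).
  apply: ereal_inf_lbound; exists F => // x /UM xM; exists 0%N => //= i.
  rewrite !mxE -ler_norml (le_trans _ xM)//.
  rewrite [leRHS]/Num.norm/= mx_normrE; apply/bigmax_geP; right => /=.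
  by exists (0, i).
rewrite nneseries_recl//; last by move=> *; exact: box_vol_ge0.
rewrite eseries0 ?adde0 ?ltry//.
by case.
Qed.

End lebesgue_Rd_measurability.

(** * Function spaces and dual norms *)

(* No integrability is needed: when both parts are infinite, [fine] sends
   [oo - oo] to 0 on both sides. *)
Lemma RintegralN d (T : measurableType d) (R : realType)
    (mu : {measure set T -> \bar R}) (D : set T) (f : T -> R) :
  \int[mu]_(x in D) (- f x) = - \int[mu]_(x in D) f x.
Proof.
rewrite /Rintegral integralE [in RHS]integralE.
have -> : (fun x => (- f x)%:E) = (\- (fun x => (f x)%:E))%E.
  by apply/funext => x; rewrite EFinN.
rewrite funenegN funeposN.
have a0 : (0 <= \int[mu]_(x in D) (fun x => (f x)%:E)^\- x)%E.
  exact: integral_ge0.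
have b0 : (0 <= \int[mu]_(x in D) (fun x => (f x)%:E)^\+ x)%E.
  exact: integral_ge0.
move: a0 b0.
case: (integral _ _ (_^\-)%E) => [a| |]; case: (integral _ _ (_^\+)%E) => [b| |] //= _ _.
- by rewrite opprB.
- by rewrite oppr0.
- by rewrite oppr0.
- by rewrite oppr0.
Qed.

Section matrix_dot.
Variables (R : realType).

Lemma mdotC m n (A B : 'M[R]_(m, n)) : mdot A B = mdot B A.
Proof. by apply: eq_bigr => i _; apply: eq_bigr => j _; rewrite mulrC. Qed.

Lemma mdotDl m n (A B C : 'M[R]_(m, n)) : mdot (A + B) C = mdot A C + mdot B C.
Proof.
rewrite /mdot -big_split; apply: eq_bigr => i _ /=.
by rewrite -big_split; apply: eq_bigr => j _; rewrite !mxE mulrDl.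
Qed.

Lemma mdotZl m n c (A B : 'M[R]_(m, n)) : mdot (c *: A) B = c * mdot A B.
Proof.
rewrite /mdot mulr_sumr; apply: eq_bigr => i _.
by rewrite mulr_sumr; apply: eq_bigr => j _; rewrite !mxE mulrA.
Qed.

Lemma mdotZr m n c (A B : 'M[R]_(m, n)) : mdot A (c *: B) = c * mdot A B.
Proof. by rewrite mdotC mdotZl mdotC. Qed.

Lemma mdot_ge0 m n (A : 'M[R]_(m, n)) : 0 <= mdot A A.
Proof. by apply: sumr_ge0 => i _; apply: sumr_ge0 => j _; rewrite -expr2 sqr_ge0. Qed.

Lemma enorm_sqr m n (A : 'M[R]_(m, n)) : enorm A ^+ 2 = mdot A A.
Proof. by rewrite sqr_sqrtr// mdot_ge0. Qed.

Lemma enormN m n (A : 'M[R]_(m, n)) : enorm (- A) = enorm A.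
Proof. by rewrite /enorm -scaleN1r mdotZl mdotZr mulN1r mulN1r opprK. Qed.

End matrix_dot.

Section L2_inner_product.
Variables (R : realType) (d : nat) (Omega : set 'rV[R]_d).

Lemma l2norm_sqr m n (U : 'rV[R]_d -> 'M[R]_(m, n)) :
  l2norm Omega U ^+ 2 = inner Omega U U.
Proof. by rewrite sqr_sqrtr//; apply: Rintegral_ge0 => x _; exact: mdot_ge0. Qed.

Lemma l2norm0_sqr (p : 'rV[R]_d -> R) :
  l2norm0 Omega p ^+ 2 = inner0 Omega p p.
Proof.
by rewrite sqr_sqrtr//; apply: Rintegral_ge0 => x _; rewrite -expr2 sqr_ge0.
Qed.

Lemma innerC m n (U V : 'rV[R]_d -> 'M[R]_(m, n)) :
  inner Omega U V = inner Omega V U.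
Proof. by apply: eq_Rintegral => x _; rewrite mdotC. Qed.

Lemma inner0C (p q : 'rV[R]_d -> R) : inner0 Omega p q = inner0 Omega q p.
Proof. by apply: eq_Rintegral => x _; rewrite mulrC. Qed.

Lemma inner0Nl (p q : 'rV[R]_d -> R) :
  inner0 Omega (fun x => - p x) q = - inner0 Omega p q.
Proof. by rewrite /inner0 -RintegralN; apply: eq_Rintegral => x _; rewrite mulNr. Qed.

Hypothesis mO : measurable (Omega : set (Rd R d)).
Hypothesis fO : (leb (Omega : set (Rd R d)) < +oo)%E.

(** Domination: [|u v| <= u^2 + v^2], and [c^2 <= 1 + c^3] for [c >= 0]. The constant 1 is
    integrable because [Omega] has finite measure. *)
Lemma Lp3_integrableM (u v : 'rV[R]_d -> R) : Lp Omega 3 u -> Lp Omega 3 v ->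
  leb.-integrable (Omega : set (Rd R d)) (fun x => (u x * v x)%:E).
Proof.
move=> [mu iu] [mv iv].
apply: (@le_integrable _ _ _ leb _ mO _
    (fun x => (1%:E + (`|u x| ^+ 3)%:E) + (`|v x| ^+ 3)%:E)%E).
- by apply/measurable_EFinP; apply: measurable_funM.
- move=> x _; rewrite -!EFinD !abse_EFin lee_fin normrM [leRHS]ger0_norm; last first.
    by rewrite !addr_ge0// exprn_ge0.
  have := normr_ge0 (u x); have := normr_ge0 (v x).
  move: `|u x| `|v x| => a b b0 a0.
  have sq (c : R) : 0 <= c -> c ^+ 2 <= 1 + c ^+ 3.
    move=> c0; have c30 := exprn_ge0 3 c0; case: (leP c 1) => c1.
      by have : c ^+ 2 <= 1 by [rewrite exprn_ile1]; lra.
    by have : c ^+ 2 <= c ^+ 3 by [rewrite ler_eXn2l// ltW]; lra.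
  by have := sq _ a0; have := sq _ b0; have := sqr_ge0 (a - b); nra.
- apply: integrableD => //; apply: integrableD => //.
  by apply/integrableP; split => //; rewrite integral_cst//= normr1 mul1e.
Qed.

Lemma integrable_mdot m n (U V : 'rV[R]_d -> 'M[R]_(m, n)) :
  LpM Omega 3 U -> LpM Omega 3 V ->
  leb.-integrable (Omega : set (Rd R d)) (fun x => (mdot (U x) (V x))%:E).
Proof.
move=> LU LV; rewrite /mdot.
under eq_fun do rewrite -sumEFin.
apply: integrable_sum => // i _.
under eq_fun do rewrite -sumEFin.
apply: integrable_sum => // j _.
exact: Lp3_integrableM.
Qed.

Lemma LpN p (u : 'rV[R]_d -> R) : Lp Omega p u -> Lp Omega p (fun x => - u x).
Proof.
move=> [mu iu]; split; last by under eq_fun do rewrite normrN.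
exact: measurableT_comp.
Qed.

End L2_inner_product.

(** * Stability of X under negation *)

Section spaceX_opp.
Variables (R : realType) (d : nat) (Omega : set 'rV[R]_d).

Lemma iter_partialN (s : seq 'I_d) (phi : 'rV[R]_d -> R) : smooth phi ->
  iter_partial s (fun x => - phi x) = (fun x => - iter_partial s phi x).
Proof.
move=> sphi; elim: s => [//|i s IH] /=; rewrite IH.
apply/funext => x; apply: deriveN; exact: (sphi s).2.
Qed.

Lemma smoothN (phi : 'rV[R]_d -> R) : smooth phi -> smooth (fun x => - phi x).
Proof.
move=> sphi s; rewrite iter_partialN//; have [cphi dphi] := sphi s; split.
  by move=> x; apply: continuousN; exact: cphi.
by move=> i x; apply: derivableN; exact: dphi.
Qed.

Lemma test_functionN (phi : 'rV[R]_d -> R) :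
  test_function Omega phi -> test_function Omega (fun x => - phi x).
Proof.
move=> [sphi [K [cK KO K0]]]; split; first exact: smoothN.
by exists K; split => // x /K0 ->; rewrite oppr0.
Qed.

Lemma classical_gradN (v : 'rV[R]_d -> 'rV[R]_d) (x : 'rV[R]_d) :
  (forall j, smooth (fun x => v x 0 j)) ->
  classical_grad (fun x => - v x) x = - classical_grad v x.
Proof.
move=> sv; apply/matrixP => i j; rewrite !mxE.
under [X in derive X]eq_fun do rewrite mxE.
by apply: deriveN; exact: (sv j [::]).2.
Qed.

Lemma zero_traceN (u : field_grad R d) :
  zero_trace Omega u -> zero_trace Omega (- u).
Proof.
move=> [phi [tphi phi0 dphi0]]; exists (fun k x => - phi k x); split.
- move=> k j; under eq_fun do rewrite mxE; exact: test_functionN.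
- move: phi0; apply: cvg_trans; apply: near_eq_cvg; near=> k.
  apply: eq_integral => x _.
  by have -> : - phi k x - (- u).1 x = - (phi k x - u.1 x); rewrite ?enormN ?opprD.
- move: dphi0; apply: cvg_trans; apply: near_eq_cvg; near=> k.
  apply: eq_integral => x _; rewrite classical_gradN; last first.
    by move=> j; exact: (tphi k j).1.
  have -> : - classical_grad (phi k) x - (- u).2 x =
    - (classical_grad (phi k) x - u.2 x) by rewrite opprD.
  by rewrite enormN.
Unshelve. all: by end_near. Qed.

Lemma spaceXN (u : field_grad R d) : spaceX Omega u -> spaceX Omega (- u).
Proof.
move=> [Lu Lgu wu zu]; split.
- by move=> i j; under eq_fun do rewrite mxE; exact: LpN.
- by move=> i j; under eq_fun do rewrite mxE; exact: LpN.
- move=> phi tphi i j /=.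
  under [X in inner0 _ X _]eq_fun do rewrite mxE.
  under [X in _ = - inner0 _ X _]eq_fun do rewrite mxE.
  by rewrite !inner0Nl wu.
- exact: zero_traceN.
Qed.

Lemma l2normN m n (U : 'rV[R]_d -> 'M[R]_(m, n)) :
  l2norm Omega (fun x => - U x) = l2norm Omega U.
Proof.
congr Num.sqrt; apply: eq_Rintegral => x _.
by rewrite -!enorm_sqr enormN.
Qed.

End spaceX_opp.

Section dual_norm_theory.
Variables (R : realType) (d : nat) (Omega : set 'rV[R]_d).
Implicit Types (F G : functional R d) (u : field_grad R d).

(** Linearity is available only on X, so the value at 0 is first computed from the combination
    [- u + u]. *)
Lemma dualX_opp F u : dualX Omega F -> spaceX Omega u -> F (- u).1 = - F u.1.
Proof.
move=> [Flin _] Xu; have Xnu := spaceXN Xu.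
have := Flin (-1) u u Xu Xu; rewrite scaleN1r addNr mulN1r addNr => F0.
have := Flin 1 u (- u) Xu Xnu; rewrite scale1r mul1r [(- u).1]/= subrr F0.
by move=> /esym/eqP; rewrite addrC addr_eq0 => /eqP.
Qed.

Lemma dualXB F G : dualX Omega F -> dualX Omega G -> dualX Omega (F - G).
Proof.
move=> [Fl [M FM]] [Gl [K GK]]; split.
  move=> a u v Xu Xv.
  have E (w : 'rV[R]_d -> 'rV[R]_d) : (F - G) w = F w - G w by [].
  by rewrite !E Fl// Gl// mulrBr opprD addrACA.
exists (M + K) => u Xu; have -> : (F - G) u.1 = F u.1 - G u.1 by [].
by rewrite (le_trans (ler_normB _ _))// mulrDl lerD ?FM ?GK.
Qed.

Lemma dualX0 : dualX Omega (0 : functional R d).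
Proof.
split; first by move=> a u v _ _; rewrite mulr0 addr0.
by exists 0 => u _; rewrite normr0 mul0r.
Qed.

Lemma dualXD F G : dualX Omega F -> dualX Omega G -> dualX Omega (F + G).
Proof.
move=> dF dG; have -> : F + G = F - (0 - G) by rewrite sub0r opprK.
by apply: dualXB => //; apply: dualXB => //; exact: dualX0.
Qed.

Lemma dualXZ (c : R) F : dualX Omega F -> dualX Omega (c *: F).
Proof.
move=> [Fl [M FM]]; split.
  move=> a u v Xu Xv.
  have E (w : 'rV[R]_d -> 'rV[R]_d) : (c *: F) w = c * F w by [].
  by rewrite !E Fl// mulrDr mulrCA.
exists (`|c| * M) => u Xu; have -> : (c *: F) u.1 = c * F u.1 by [].
by rewrite normrM -mulrA ler_wpM2l// FM.
Qed.

Let quotients F := [set F u.1 / l2norm Omega u.2 | u in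
  [set u | spaceX Omega u /\ l2norm Omega u.2 != 0]].

Lemma l2norm_ge0 m n (U : 'rV[R]_d -> 'M[R]_(m, n)) : 0 <= l2norm Omega U.
Proof. exact: sqrtr_ge0. Qed.

Let quotients_ub F : dualX Omega F -> has_ubound (quotients F).
Proof.
move=> [_ [M FM]]; exists M => _ [u [Xu u0] <-].
rewrite ler_pdivrMr ?lt_neqAle 1?eq_sym ?u0 ?l2norm_ge0//.
exact: le_trans (ler_norm _) (FM _ Xu).
Qed.

Let quotients_opp F u : dualX Omega F -> spaceX Omega u ->
  l2norm Omega u.2 != 0 -> quotients F (- (F u.1 / l2norm Omega u.2)).
Proof.
move=> dF Xu u0; exists (- u).
  by split; [exact: spaceXN | rewrite [(- u).2]/= l2normN].
by rewrite dualX_opp// [(- u).2]/= l2normN mulNr.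
Qed.

(** The supremum in [dual_norm] carries no absolute value: nonnegativity comes from negating [u],
    which puts the opposite of each quotient in the set. If X has no element with nonzero gradient,
    the supremum of the empty set is 0. *)
Lemma dual_norm_ge0 F : dualX Omega F -> 0 <= dual_norm Omega F.
Proof.
move=> dF; rewrite /dual_norm -/(quotients F).
have [->|/set0P[_ [u [Xu u0] _]]] := eqVneq (quotients F) set0.
  by rewrite sup0.
have h1 : F u.1 / l2norm Omega u.2 <= sup (quotients F).
  by apply: ub_le_sup; [exact: quotients_ub|exists u].
have h2 : - (F u.1 / l2norm Omega u.2) <= sup (quotients F).
  by apply: ub_le_sup; [exact: quotients_ub|exact: quotients_opp].
by lra.
Qed.

Lemma dual_norm_bound F u : dualX Omega F -> spaceX Omega u ->
  `|F u.1| <= dual_norm Omega F * l2norm Omega u.2.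
Proof.
(* A field whose gradient norm is 0 is excluded from the supremum; boundedness of [F] on X forces
   [F u.1 = 0] there. *)
move=> dF Xu; have [u0|u0] := eqVneq (l2norm Omega u.2) 0.
  by have [_ [M FM]] := dF; have := FM _ Xu; rewrite u0 !mulr0.
have up : 0 < l2norm Omega u.2 by rewrite lt_neqAle eq_sym u0 l2norm_ge0.
rewrite -ler_pdivrMr// -[X in _ / X](ger0_norm (l2norm_ge0 _)) -normf_div.
rewrite ler_norml lerNl; apply/andP; split.
  by apply: ub_le_sup; [exact: quotients_ub|exact: quotients_opp].
by apply: ub_le_sup; [exact: quotients_ub|exists u].
Qed.

Lemma dual_norm_le F (M : R) : 0 <= M ->
  (forall u, spaceX Omega u -> F u.1 <= M * l2norm Omega u.2) ->
  dual_norm Omega F <= M.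
Proof.
move=> M0 FM; rewrite /dual_norm -/(quotients F).
have [->|/set0P Q0] := eqVneq (quotients F) set0; first by rewrite sup0.
apply: ge_sup => // _ [u [Xu u0] <-].
by rewrite ler_pdivrMr ?lt_neqAle 1?eq_sym ?u0 ?l2norm_ge0// FM.
Qed.

(** The reverse triangle inequality, which will carry measurability from simple functions to their
    limits. *)
Lemma dual_norm_dist F G : dualX Omega F -> dualX Omega G ->
  `|dual_norm Omega F - dual_norm Omega G| <= dual_norm Omega (F - G).
Proof.
move=> dF dG; have dFG := dualXB dF dG.
rewrite ler_distl; apply/andP; split.
  rewrite lerBlDr; apply: dual_norm_le.
    by rewrite addr_ge0// dual_norm_ge0.
  move=> u Xu; have -> : G u.1 = F u.1 - (F - G) u.1.
    have -> : (F - G) u.1 = F u.1 - G u.1 by [].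
    by rewrite subKr.
  have := dual_norm_bound dF Xu; have := dual_norm_bound dFG Xu.
  by rewrite !ler_norml => /andP[? ?] /andP[? ?]; rewrite mulrDl; lra.
apply: dual_norm_le; first by rewrite addr_ge0// dual_norm_ge0.
move=> u Xu; have -> : F u.1 = G u.1 + (F - G) u.1.
  have -> : (F - G) u.1 = F u.1 - G u.1 by [].
  by rewrite addrC subrK.
have := dual_norm_bound dG Xu; have := dual_norm_bound dFG Xu.
by rewrite !ler_norml => /andP[? ?] /andP[? ?]; rewrite mulrDl; lra.
Qed.

End dual_norm_theory.

(** * Smooth functions of a real variable *)

Section smooth_functions_of_a_real_variable.
Variable R : realType.
Implicit Types f g : R -> R.

(** Each derivative is exhibited as a witness, so that closure under sums, products, inverses and
    affine substitution follows by induction on the order; [ntimes_derivableP] returns to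
    [derive1n]. *)
Fixpoint ntimes_derivable n f : Prop :=
  if n is m.+1 then
    exists2 f' : R -> R, (forall x, is_derive x (1 : R) f (f' x)) &
      ntimes_derivable m f'
  else True.

Lemma ntimes_derivableS n f : ntimes_derivable n.+1 f -> ntimes_derivable n f.
Proof.
elim: n f => [//|n IH] f [f' ff' nf']; exists f' => //; exact: IH.
Qed.

Lemma derive1_is_derive f f' : (forall x, is_derive x (1 : R) f (f' x)) ->
  derive1 f = f'.
Proof. by move=> ff'; apply/funext => x; rewrite derive1E derive_val. Qed.

Lemma ntimes_derivableP f : (forall n, ntimes_derivable n f) ->
  forall n x, derivable (derive1n n f) x 1.
Proof.
move=> sf n; have := sf n.+1; elim: n f {sf} => [|n IH] f [f' ff' nf'] x.
  by rewrite derive1n0; have := ff' x.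
by rewrite derive1Sn (derive1_is_derive ff'); exact: IH.
Qed.

Lemma ntimes_derivable_cst n c : ntimes_derivable n (fun=> c).
Proof.
elim: n c => [//|n IH] c; exists (fun=> 0) => // x.
exact: is_derive_cst.
Qed.

Lemma ntimes_derivable_id n : ntimes_derivable n (fun x => x).
Proof.
case: n => [//|n]; exists (fun=> 1) => [x|]; first exact: is_derive_id.
exact: ntimes_derivable_cst.
Qed.

Lemma ntimes_derivableD n f g : ntimes_derivable n f -> ntimes_derivable n g ->
  ntimes_derivable n (fun x => f x + g x).
Proof.
elim: n f g => [//|n IH] f g [f' ff' nf] [g' gg' ng].
exists (fun x => f' x + g' x); last exact: IH.
by move=> x; exact: is_deriveD.
Qed.

Lemma ntimes_derivableM n f g : ntimes_derivable n f -> ntimes_derivable n g ->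
  ntimes_derivable n (fun x => f x * g x).
Proof.
elim: n f g => [//|n IH] f g nf ng.
have nf1 := ntimes_derivableS nf; have ng1 := ntimes_derivableS ng.
case: nf ng => f' ff' nf [g' gg' ng].
exists (fun x => f x * g' x + g x * f' x).
  by move=> x; exact: is_deriveM.
by apply: ntimes_derivableD; exact: IH.
Qed.

Lemma ntimes_derivableV n f : (forall x, f x != 0) -> ntimes_derivable n f ->
  ntimes_derivable n (fun x => (f x)^-1).
Proof.
move=> f0; elim: n => [//|n IH] nf.
have nfV := IH (ntimes_derivableS nf); case: nf => f' ff' nf.
exists (fun x => - 1 * (f x)^-1 * (f x)^-1 * f' x).
  move=> x; apply: DeriveDef; first by apply: derivableV.
  rewrite deriveV//.
  by rewrite derive_val /GRing.scale /= expr2 invfM mulN1r !mulNr.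
by do !apply: ntimes_derivableM => //; exact: ntimes_derivable_cst.
Qed.

Lemma is_derive1_comp f g (x df dg : R) :
  is_derive x (1 : R) f df -> is_derive (f x) (1 : R) g dg ->
  is_derive x (1 : R) (fun y => g (f y)) (dg * df).
Proof.
move=> df1 dg1; apply: DeriveDef; last first.
  by rewrite -derive1E (@derive1_comp _ f g)// !derive1E !derive_val.
apply/derivable1_diffP; apply: (@differentiable_comp _ _ _ _ f g).
  exact/derivable1_diffP.
exact/derivable1_diffP.
Qed.

Lemma is_derive_comp_affine f f' (a b : R) :
  (forall x, is_derive x (1 : R) f (f' x)) ->
  forall x, is_derive x (1 : R) (fun y => f (a * y + b)) (a * f' (a * x + b)).
Proof.
move=> ff' x.
have dh : is_derive x (1 : R) (fun y : R => a * y + b) a.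
  have : is_derive x (1 : R) (a \*: (@id R) + cst b) (a *: 1 + 0).
    by apply: is_deriveD; apply: is_deriveZ.
  by rewrite [_ + 0]addr0 [_ *: _]mulr1.
by rewrite mulrC; exact: is_derive1_comp.
Qed.

Lemma ntimes_derivable_affine n f (a b : R) : ntimes_derivable n f ->
  ntimes_derivable n (fun x => f (a * x + b)).
Proof.
elim: n f => [//|n IH] f [f' ff' nf].
exists (fun x => a * f' (a * x + b)); first exact: is_derive_comp_affine.
by apply: ntimes_derivableM; [exact: ntimes_derivable_cst|exact: IH].
Qed.

(* Up to the choice of [p], every derivative of [exp (-1/x)] extended by 0 has
   this form. *)
Definition flat (p : {poly R}) (x : R) : R :=
  if 0 < x then p.[x^-1] * expR (- x^-1) else 0.

(** Termwise, [y^i <= i! exp y] by the exponential series. *)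
Lemma horner_le_exp (p : {poly R}) :
  exists2 C, 0 <= C & forall y, 1 <= y -> `|p.[y]| <= C * expR y.
Proof.
exists (\sum_(i < size p) `|p`_i| * i`!%:R).
  by apply: sumr_ge0 => i _; rewrite mulr_ge0// ler0n.
move=> y y1; rewrite horner_coef (le_trans (ler_norm_sum _ _ _))//.
rewrite mulr_suml; apply: ler_sum => i _; rewrite normrM -mulrA ler_wpM2l//.
have y0 : 0 <= y by exact: le_trans y1.
rewrite ger0_norm ?exprn_ge0//.
case: (val i) => [|k].
  by rewrite expr0 fact0 mul1r -expR0 ler_expR.
rewrite -ler_pdivrMl ?ltr0n ?fact_gt0// mulrC.
by apply: le_trans (expR_ge1Dxn k y0); rewrite lerDr.
Qed.

(** The exponential bound is applied to ['X^2 * p] rather than [p]; the extra factor [x^-2] is what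
    yields [x ^+ 2]. *)
Lemma flat_le_sqr (p : {poly R}) :
  exists2 C, 0 <= C & forall x, x <= 1 -> `|flat p x| <= C * x ^+ 2.
Proof.
have [C C0 pC] := horner_le_exp ('X^2 * p); exists C => // x x1.
rewrite /flat; case: ifPn => x0; last by rewrite normr0 mulr_ge0// sqr_ge0.
have := pC x^-1; rewrite invf_ge1// => /(_ x1).
have y0 : 0 <= x^-1 by rewrite invr_ge0 ltW.
rewrite hornerM hornerXn normrM (ger0_norm (exprn_ge0 _ y0)) => h.
rewrite normrM (ger0_norm (expR_ge0 _)) expRN.
rewrite ler_pdivrMr ?expR_gt0//.
have -> : `|p.[x^-1]| = x ^+ 2 * (x^-1 ^+ 2 * `|p.[x^-1]|).
  by rewrite mulrA -exprMn divff ?gt_eqF// expr1n mul1r.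
by rewrite (mulrC C) -[leRHS]mulrA ler_wpM2l// exprn_ge0// ltW.
Qed.

(** For [x > 0], differentiating [p(1/x)] and [exp(-1/x)] gives the factors [- p'(1/x) / x^2] and
    [1 / x^2], hence the new polynomial. At 0 the quadratic bound makes the difference quotient tend
    to 0. *)
Lemma is_derive_flat (p : {poly R}) (x : R) :
  is_derive x (1 : R) (flat p) (flat ('X^2 * (p - p^`())) x).
Proof.
have [x0|x0|->] := ltgtP x 0.
- have -> : flat ('X^2 * (p - p^`())) x = 0 by rewrite /flat ltNge (ltW x0).
  apply: (@near_eq_is_derive _ _ _ (cst 0)).
  near=> y; rewrite /flat ifN// -leNgt ltW//; near: y; exact: lt_nbhsl.
- have -> : flat ('X^2 * (p - p^`())) x =
    ('X^2 * (p - p^`())).[x^-1] * expR (- x^-1) by rewrite /flat x0.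
  apply: (@near_eq_is_derive _ R R (fun y : R => p.[y^-1] * expR (- y^-1))).
    near=> y; rewrite /flat ifT//; near: y; exact: lt_nbhsr.
  have dV : is_derive x (1 : R) (fun y : R => y^-1) (- x ^- 2).
    apply: DeriveDef; first by apply: derivableV; rewrite ?gt_eqF.
    by rewrite (@deriveV _ _ id) ?gt_eqF// derive_id [_ *: _]mulr1.
  have dpV := is_derive1_comp dV (is_derive_poly p x^-1).
  have deV := is_derive1_comp (is_deriveN dV) (is_derive_expR (- x^-1)).
  apply: (is_derive_eq (is_deriveM dpV deV)).
  by rewrite !hornerE /GRing.scale /= exprVn; ring.
- have -> : flat ('X^2 * (p - p^`())) 0 = 0 by rewrite /flat ltxx.
  have [C C0 pC] := flat_le_sqr p.
  have p0 : flat p 0 = 0 by rewrite /flat ltxx.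
  have L : h^-1 *: ((flat p \o shift 0) (h *: (1 : R)) - flat p 0)
      @[h --> (0 : R)^'] --> (0 : R).
    apply/cvgrPdist_le => /= e e0; near=> h.
    have h0 : 0 < `|h| by rewrite normr_gt0; near: h; exact: nbhs_dnbhs_neq.
    rewrite p0 subr0 addr0 [h *: 1]mulr1 sub0r normrN [_ *: _]mulrC normrM normfV.
    rewrite ler_pdivrMr// (le_trans (pC _ _))//.
      by rewrite (le_trans (ler_norm _))//; near: h; apply: dnbhs0_le.
    rewrite -real_normK ?num_real// expr2 mulrA ler_wpM2r//.
    have : `|h| <= e / (C + 1).
      by near: h; apply: dnbhs0_le; rewrite divr_gt0// ltr_wpDl.
    rewrite ler_pdivlMr ?ltr_wpDl// mulrDr mulr1 mulrC; apply: le_trans.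
    by rewrite lerDl.
  apply: DeriveDef; last exact: cvg_lim L.
  by apply/cvg_ex; exists 0.
Unshelve. all: by end_near. Qed.

Lemma ntimes_derivable_flat n p : ntimes_derivable n (flat p).
Proof.
elim: n p => [//|n IH] p; exists (flat ('X^2 * (p - p^`()))) => //.
exact: is_derive_flat.
Qed.

End smooth_functions_of_a_real_variable.

(** * Mollified positive parts and the approximate Dirac masses they have as second derivatives *)

Section smooth_ramp.
Variable R : realType.
Local Notation mu := (@lebesgue_measure R).

Lemma ntimes_derivable_derive1n m n (f : R -> R) :
  ntimes_derivable (m + n) f -> ntimes_derivable n (derive1n m f).
Proof.
elim: m f => [//|m IH] f; rewrite addSn => -[f' ff' nf'].
by rewrite derive1Sn (derive1_is_derive ff'); exact: IH.
Qed.

Lemma ntimes_derivable_is_derive (f : R -> R) : ntimes_derivable 1 f ->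
  forall x, is_derive x (1 : R) f (derive1 f x).
Proof. by move=> [f' ff' _] x; rewrite (derive1_is_derive ff'). Qed.

Lemma ntimes_derivable_sum m n (F : 'I_m -> R -> R) :
  (forall i, ntimes_derivable n (F i)) ->
  ntimes_derivable n (fun x => \sum_i F i x).
Proof.
elim: m F => [|m IH] F nF.
  under eq_fun do rewrite big_ord0.
  exact: ntimes_derivable_cst.
under eq_fun do rewrite big_ord_recl.
by apply: ntimes_derivableD => //; apply: IH.
Qed.

Lemma is_derive_lincomb m (c : 'I_m -> R) (F F' : 'I_m -> R -> R) x :
  (forall i, is_derive x (1 : R) (F i) (F' i x)) ->
  is_derive x (1 : R) (fun y => \sum_i c i * F i y) (\sum_i c i * F' i x).
Proof.
elim: m c F F' => [|m IH] c F F' FF'.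
  by under eq_fun do rewrite big_ord0; rewrite big_ord0; exact: is_derive_cst.
under eq_fun do rewrite big_ord_recl.
rewrite big_ord_recl.
have d0 : is_derive x (1 : R) (fun y => c ord0 * F ord0 y) (c ord0 * F' ord0 x).
  exact: (is_deriveZ (c ord0) (FF' ord0)).
have dS := IH (fun i => c (lift ord0 i)) (fun i => F (lift ord0 i))
  (fun i => F' (lift ord0 i)) (fun i => FF' (lift ord0 i)).
exact: is_deriveD d0 dS.
Qed.

Lemma derive1n_lincomb m n (c : 'I_m -> R) (F : 'I_m -> R -> R) :
  (forall i k, ntimes_derivable k (F i)) ->
  derive1n n (fun x => \sum_i c i * F i x) =
  (fun x => \sum_i c i * derive1n n (F i) x).
Proof.
elim: n F => [//|n IH] F nF; rewrite derive1Sn.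
have -> : derive1 (fun x => \sum_i c i * F i x) =
    (fun x => \sum_i c i * derive1 (F i) x).
  apply: derive1_is_derive => x.
  exact: (is_derive_lincomb c (F' := fun i => derive1 (F i))
    (fun i => ntimes_derivable_is_derive (nF i 1%N) x)).
rewrite IH; last first.
  by move=> i k; exact: (@ntimes_derivable_derive1n 1 k (F i) (nF i k.+1)).
by apply/funext => x; apply: eq_bigr => i _; rewrite derive1Sn.
Qed.

(** The usual smooth transition from 0 on ]-oo, -1] to 1 on [1, +oo[. The affine arguments have the
    shape [a * s + b] of [ntimes_derivable_affine]. *)
Definition smooth_step (s : R) : R :=
  flat 1 (1 * s + 1) * (flat 1 (1 * s + 1) + flat 1 (- 1 * s + 1))^-1.

(* A smooth version of the positive part, equal to it outside [-1, 1]. *)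
Definition ramp (s : R) : R := s * smooth_step s.

Lemma flat1_ge0 (x : R) : 0 <= flat 1 x.
Proof. by rewrite /flat; case: ifP => // _; rewrite hornerC mul1r expR_ge0. Qed.

Lemma flat1_gt0 (x : R) : 0 < x -> 0 < flat 1 x.
Proof. by rewrite /flat => ->; rewrite hornerC mul1r expR_gt0. Qed.

Lemma flat1_eq0 (x : R) : x <= 0 -> flat 1 x = 0.
Proof. by rewrite /flat leNgt => /negbTE ->. Qed.

Lemma smooth_step_den_gt0 (s : R) : 0 < flat 1 (1 * s + 1) + flat 1 (- 1 * s + 1).
Proof.
case: (leP s 0) => s0.
  by rewrite ltr_wpDl ?flat1_ge0 ?flat1_gt0//; lra.
by rewrite ltr_pwDl ?flat1_ge0 ?flat1_gt0//; lra.
Qed.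

Lemma ntimes_derivable_ramp n : ntimes_derivable n ramp.
Proof.
apply: ntimes_derivableM; first exact: ntimes_derivable_id.
apply: ntimes_derivableM.
  by apply: ntimes_derivable_affine; exact: ntimes_derivable_flat.
apply: ntimes_derivableV; first by move=> x; rewrite gt_eqF ?smooth_step_den_gt0.
by apply: ntimes_derivableD; apply: ntimes_derivable_affine;
  exact: ntimes_derivable_flat.
Qed.

Lemma ramp_le (s : R) : s <= - 1 -> ramp s = 0.
Proof.
by move=> s1; rewrite /ramp /smooth_step flat1_eq0 ?mul0r ?mulr0//; lra.
Qed.

Lemma ramp_ge (s : R) : 1 <= s -> ramp s = s.
Proof.
move=> s1; have := smooth_step_den_gt0 s; rewrite /ramp /smooth_step.
have -> : flat 1 (- 1 * s + 1) = 0 by rewrite flat1_eq0//; lra.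
by rewrite addr0 => d0; rewrite divff ?gt_eqF// mulr1.
Qed.

Lemma ler_norm_ramp (s : R) : `|ramp s| <= `|s|.
Proof.
rewrite normrM ler_piMr// /smooth_step ger0_norm.
  by rewrite ler_pdivrMr ?smooth_step_den_gt0// [leRHS]mul1r lerDl flat1_ge0.
by rewrite divr_ge0 ?flat1_ge0// ltW// smooth_step_den_gt0.
Qed.

Let ramp1 : R -> R := derive1 ramp.
Let ramp2 : R -> R := derive1 ramp1.

Let is_derive_ramp s : is_derive s (1 : R) ramp (ramp1 s).
Proof. exact: ntimes_derivable_is_derive (ntimes_derivable_ramp 1) _. Qed.

Let is_derive_ramp1 s : is_derive s (1 : R) ramp1 (ramp2 s).
Proof.
apply: ntimes_derivable_is_derive.
exact: (@ntimes_derivable_derive1n 1 1 ramp (ntimes_derivable_ramp 2)).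
Qed.

Let ramp1_lt s : s < - 1 -> ramp1 s = 0.
Proof.
move=> s1; rewrite /ramp1 derive1E (@near_eq_derive _ R R _ (cst 0)) ?derive_cst//.
by near=> y; rewrite ramp_le// ltW//; near: y; exact: lt_nbhsl.
Unshelve. all: by end_near. Qed.

Let ramp1_gt s : 1 < s -> ramp1 s = 1.
Proof.
move=> s1; rewrite /ramp1 derive1E (@near_eq_derive _ R R _ id) ?derive_id//.
by near=> y; rewrite ramp_ge// ltW//; near: y; exact: lt_nbhsr.
Unshelve. all: by end_near. Qed.

Let ramp2_out s : 1 < `|s| -> ramp2 s = 0.
Proof.
rewrite lter_normr => /orP[s1|s1].
  rewrite /ramp2 derive1E (@near_eq_derive _ R R _ (cst 1)) ?derive_cst//.
  by near=> y; rewrite ramp1_gt//; near: y; exact: lt_nbhsr.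
rewrite /ramp2 derive1E (@near_eq_derive _ R R _ (cst 0)) ?derive_cst//.
near=> y; rewrite ramp1_lt//; near: y; apply: lt_nbhsl; lra.
Unshelve. all: by end_near. Qed.

Lemma is_derive_continuous (f f' : R -> R) :
  (forall x, is_derive x (1 : R) f (f' x)) -> continuous f.
Proof.
move=> ff' x; apply: differentiable_continuous; apply/derivable1_diffP.
by have := ff' x.
Qed.

Let continuous_ramp2 : continuous ramp2.
Proof.
apply: (@is_derive_continuous _ (derive1 ramp2)).
apply: ntimes_derivable_is_derive.
exact: (@ntimes_derivable_derive1n 2 1 ramp (ntimes_derivable_ramp 3)).
Qed.

(** The second derivative is continuous and vanishes outside [-1, 1], so its maximum on that segment
    is global. *)
Lemma ramp2_bounded : exists2 M, 0 <= M & forall s, `|ramp2 s| <= M.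
Proof.
have [||c _ cM] := @EVT_max R (fun s => `|ramp2 s|) (- 1) 1.
- lra.
- apply: continuous_subspaceT => x.
  by apply: continuous_comp; [exact: continuous_ramp2|exact: norm_continuous].
exists `|ramp2 c| => [|s]; first exact: normr_ge0.
have [s1|s1] := leP `|s| 1.
  by apply: cM; rewrite in_itv /= -ler_norml.
by rewrite ramp2_out// normr0.
Qed.

(** The positive part of [s - a] mollified at scale [h]; [ramp_bump] is its second derivative, an
    approximation of the Dirac mass at [a]. *)
Definition ramp_at (h a s : R) : R := h * ramp (h^-1 * s + - (a / h)).
Definition ramp_bump (h a s : R) : R := h^-1 * ramp2 (h^-1 * s + - (a / h)).
Let ramp_slope (h a s : R) : R := ramp1 (h^-1 * s + - (a / h)).

Variables (h a : R).
Hypothesis h0 : 0 < h.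

Let rescale s : h^-1 * s + - (a / h) = (s - a) / h.
Proof. by rewrite mulrBl mulrC. Qed.

Lemma ntimes_derivable_ramp_at n : ntimes_derivable n (ramp_at h a).
Proof.
apply: ntimes_derivableM; first exact: ntimes_derivable_cst.
by apply: ntimes_derivable_affine; exact: ntimes_derivable_ramp.
Qed.

Let is_derive_ramp_at s : is_derive s (1 : R) (ramp_at h a) (ramp_slope h a s).
Proof.
have := is_deriveZ h (is_derive_comp_affine h^-1 (- (a / h)) is_derive_ramp s).
by rewrite [h *: _]mulrA divff ?mul1r// gt_eqF.
Qed.

Let is_derive_ramp_slope s :
  is_derive s (1 : R) (ramp_slope h a) (ramp_bump h a s).
Proof. exact: is_derive_comp_affine. Qed.

Lemma derive1n2_ramp_at : derive1n 2 (ramp_at h a) = ramp_bump h a.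
Proof.
by rewrite derive1Sn derive1n1 (derive1_is_derive is_derive_ramp_at)
  (derive1_is_derive is_derive_ramp_slope).
Qed.

Lemma ramp_at_le s : s <= a - h -> ramp_at h a s = 0.
Proof.
by move=> sa; rewrite /ramp_at rescale ramp_le ?mulr0// ler_pdivrMr//; lra.
Qed.

Lemma ramp_at_ge s : a + h <= s -> ramp_at h a s = s - a.
Proof.
move=> sa; rewrite /ramp_at rescale ramp_ge; last by rewrite ler_pdivlMr//; lra.
by rewrite mulrC divfK// gt_eqF.
Qed.

(** The bound is free of [h], so the kernel estimate survives the removal of the mollification. *)
Lemma ler_norm_ramp_at s : `|ramp_at h a s| <= `|s - a|.
Proof.
rewrite /ramp_at rescale normrM (le_trans (ler_wpM2l _ (ler_norm_ramp _)))//.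
by rewrite -normrM mulrC divfK// gt_eqF.
Qed.

Lemma ramp_bump_out s : h < `|s - a| -> ramp_bump h a s = 0.
Proof.
move=> sa; rewrite /ramp_bump rescale ramp2_out ?mulr0//.
by rewrite normrM normfV (gtr0_norm h0) ltr_pdivlMr// mul1r.
Qed.

Lemma continuous_ramp_bump : continuous (ramp_bump h a).
Proof.
apply: (@is_derive_continuous _ (derive1 (ramp_bump h a))).
rewrite -derive1n2_ramp_at.
apply: ntimes_derivable_is_derive.
exact: (@ntimes_derivable_derive1n 2 1 _ (ntimes_derivable_ramp_at 3)).
Qed.

(** By the fundamental theorem of calculus the integral is the increase of the slope, from 0 left of
    the bump to 1 right of it. *)
Lemma integral_ramp_bump (x y : R) : x < a - h -> a + h < y ->
  \int[mu]_(s in `]x, y[) ramp_bump h a s = 1.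
Proof.
move=> xa ay; have xy : x < y by have := h0; lra.
have cs : continuous (ramp_slope h a).
  exact: is_derive_continuous is_derive_ramp_slope.
have cb : {within `[x, y], continuous (ramp_bump h a)}.
  by apply: continuous_subspaceT; exact: continuous_ramp_bump.
have ib := continuous_compact_integrable (@segment_compact _ x y) cb.
rewrite Rintegral_itv_obnd_cbnd; last first.
  by apply: integrableS ib => //; exact: subset_itv_oo_cc.
rewrite Rintegral_itv_bndo_bndc; last first.
  by apply: integrableS ib => //; exact: subset_itv_co_cc.
rewrite /Rintegral (@continuous_FTC2 _ _ (ramp_slope h a))//.
- rewrite /= /ramp_slope !rescale ramp1_gt ?ramp1_lt ?subr0//.
    by rewrite ltr_pdivrMr//; lra.
  by rewrite ltr_pdivlMr//; lra.
- split; first by move=> s _; exact: (@ex_derive _ _ _ _ _ _ _ (is_derive_ramp_slope s)).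
    exact/cvg_at_right_filter/cs.
  exact/cvg_at_left_filter/cs.
- by move=> s _; rewrite (derive1_is_derive is_derive_ramp_slope).
Qed.

End smooth_ramp.

(** [ramp] is negative on ]-1, 0[, so the bump changes sign and its unit integral does not control
    its L^1 norm. The bound [M / h] on a support of length [2 * h] does. *)
Lemma ramp_bump_bounded (R : realType) : exists2 M : R, 0 <= M &
  forall h a s : R, 0 < h -> `|ramp_bump h a s| <= M / h.
Proof.
have [M M0 rM] := ramp2_bounded R; exists M => // h a s h0.
by rewrite normrM normfV (gtr0_norm h0) mulrC ler_wpM2r// invr_ge0 ltW.
Qed.

(** * Weighted point values of a function with a weak second derivative *)

Lemma Rintegral_setS d (T : measurableType d) (R : realType)
    (mu : {measure set T -> \bar R}) (D E : set T) (f : T -> R) :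
  D `<=` E -> (forall x, E x -> ~ D x -> f x = 0) ->
  \int[mu]_(x in E) f x = \int[mu]_(x in D) f x.
Proof.
move=> DE f0; rewrite Rintegral_mkcond [RHS]Rintegral_mkcond.
congr Rintegral; apply/funext => x; rewrite !patchE.
case: ifPn => xE; case: ifPn => xD //.
  by apply: f0; [exact/set_mem|move/mem_set; exact/negP].
by move: xE; rewrite mem_set//; apply: DE; exact: set_mem.
Qed.

Lemma Rintegral_lincomb d (T : measurableType d) (R : realType)
    (mu : {measure set T -> \bar R}) (D : set T) m (c : 'I_m -> R)
    (F : 'I_m -> T -> R) : measurable D ->
  (forall i, mu.-integrable D (EFin \o F i)) ->
  mu.-integrable D (EFin \o (fun x => \sum_i c i * F i x)) /\
  \int[mu]_(x in D) (\sum_i c i * F i x) = \sum_i c i * \int[mu]_(x in D) F i x.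
Proof.
move=> mD; elim: m c F => [|m IH] c F iF.
  under [X in EFin \o X]eq_fun do rewrite big_ord0.
  under eq_Rintegral do rewrite big_ord0.
  split; first exact: integrable0.
  by rewrite big_ord0 Rintegral_cst// mul0r.
have [iS ES] := IH (fun i => c (lift ord0 i)) (fun i => F (lift ord0 i))
  (fun i => iF (lift ord0 i)).
have i0 : mu.-integrable D (EFin \o (fun x => c ord0 * F ord0 x)).
  by have := integrableZl mD (c ord0) (iF ord0).
under [X in EFin \o X]eq_fun do rewrite big_ord_recl.
under eq_Rintegral do rewrite big_ord_recl.
split; first exact: (integrableD mD i0 iS).
by rewrite (RintegralD mD i0 iS) big_ord_recl ES RintegralZl.
Qed.

Section weighted_point_values.
Variables (R : realType) (T : R) (phi : R -> R).
Local Notation mu := (@lebesgue_measure R).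
Hypothesis cphi : {within `[0, T], continuous (phi : R -> R^o)}.

Let integrable_oo (f : R -> R^o) : {within `[0, T], continuous f} ->
  mu.-integrable `]0, T[ (EFin \o f).
Proof.
move=> cf.
have := continuous_compact_integrable (@segment_compact _ 0 T) cf.
by apply: integrableS => //; exact: subset_itv_oo_cc.
Qed.

Let integrable_phiM (f : R -> R) : continuous f ->
  mu.-integrable `]0, T[ (EFin \o (fun x => phi x * f x)).
Proof.
move=> cf; apply: integrable_oo => x.
apply: (@continuousM R (subspace `[0, T])); first exact: cphi.
exact: continuous_subspaceT.
Qed.

(** The centre [q] may differ from [p] by [2 * h], uniformly in [q]: when [p] is 0 or [T], a bump
    centred at [p] would leave the interval. *)
Lemma ramp_bump_approx (p e : R) : 0 <= p <= T -> 0 < e ->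
  \forall h \near 0^'+, forall q, `|q - p| <= 2 * h -> h < q -> q + h < T ->
    `|\int[mu]_(s in `]0, T[) (phi s * ramp_bump h q s) - phi p| <= e.
Proof.
move=> pT e0; have [M M0 bM] := ramp_bump_bounded R.
(* The final integral is at most [e1 * (M / h)] times the length [2 * h], that is [2 * M * e1]; the
   [+ 1] keeps the divisor positive. *)
pose e1 := e / (2 * M + 1).
have e10 : 0 < e1 by rewrite divr_gt0// ltr_wpDl// mulr_ge0.
have phip : phi @ within `[0, T] (nbhs p) --> (phi p : R^o).
  by move/subspace_continuousP : cphi; apply; rewrite /= in_itv.
move/cvgrPdist_le : phip => /(_ _ e10).
rewrite near_withinE => /nbhs_ballP[d /= d0 pd].
near=> h => q qp hq qT.
have h0 : 0 < h by near: h; exact: nbhs_right_gt.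
(* A point of the support is within [h] of [q], hence within [3 * h] of [p]. *)
have hd : h < d / 3 by near: h; apply: nbhs_right_lt; rewrite divr_gt0.
have cb := @continuous_ramp_bump R h q h0.
have i1 := integrable_phiM cb.
have i2 : mu.-integrable `]0, T[ (EFin \o (fun x => phi p * ramp_bump h q x)).
  apply: integrable_oo; apply: continuous_subspaceT => x.
  by apply: continuousM; [exact: cst_continuous|exact: cb].
have i3 : mu.-integrable `]0, T[ (EFin \o ramp_bump h q).
  by apply: integrable_oo; exact: continuous_subspaceT.
(* Writing [phi p] as [phi p] times the unit mass brings the difference under one integral. *)
rewrite -[phi p]mulr1 -(@integral_ramp_bump R h q h0 0 T)//; last by rewrite subr_gt0.
rewrite -RintegralZl//; rewrite -RintegralB//.
have sub : `[q - h, q + h]%classic `<=` `]0, T[%classic.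
  by move=> x /=; rewrite !in_itv /= => /andP[? ?]; apply/andP; split; lra.
rewrite (@Rintegral_setS _ _ R mu _ _
  (fun x => phi x * ramp_bump h q x - phi p * ramp_bump h q x) sub); last first.
  move=> x _ /= xq; rewrite ramp_bump_out ?mulr0 ?subrr//.
  rewrite ltNge; apply/negP => xqh; apply: xq; rewrite in_itv /=.
  by move: xqh; rewrite ler_norml => /andP[? ?]; apply/andP; split; lra.
have i4 : mu.-integrable `[q - h, q + h]
    (EFin \o (fun x => phi x * ramp_bump h q x - phi p * ramp_bump h q x)).
  have := integrableB _ i1 i2; move=> /(_ (measurable_itv _)).
  exact: integrableS.
rewrite (le_trans (le_normr_Rintegral _ i4))//.
apply: (@le_trans _ _ (\int[mu]_(x in `[q - h, q + h]) (e1 * (M / h)))).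
  apply: le_Rintegral => //.
  - exact: integrable_norm.
  - apply: continuous_compact_integrable; first exact: segment_compact.
    by apply: continuous_subspaceT => x; exact: cst_continuous.
  move=> x /= xq; rewrite -mulrBl normrM ler_pM ?bM//.
  have xT : `]0, T[%classic x by exact: sub.
  rewrite distrC; apply: pd; last first.
    by move: xT => /=; rewrite !in_itv /= => /andP[/ltW -> /ltW ->].
  rewrite /ball /=; move: xq qp; rewrite in_itv /= ler_norml ltr_norml.
  by move=> /andP[? ?] /andP[? ?]; apply/andP; split; lra.
rewrite Rintegral_cst//= lebesgue_measure_itv/= lte_fin ifT; last by lra.
rewrite -EFinB /=.
have -> : e1 * (M / h) * (q + h - (q - h)) = e1 * (2 * M).
  by field; rewrite gt_eqF.
rewrite /e1 mulrAC ler_pdivrMr ?ltr_wpDl ?mulr_ge0//.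
by rewrite ler_wpM2l ?(ltW e0)// lerDl.
Unshelve. all: by end_near. Qed.

Variables (g G : R -> R).
Hypothesis mg : measurable_fun `]0, T[ g.
Hypothesis gG : forall s, `]0, T[%classic s -> `|g s| <= G s.
Hypothesis iG : mu.-integrable `]0, T[ (EFin \o G).
Hypothesis weak_phi : forall psi : R -> R, time_test_function T psi ->
  \int[mu]_(s in `]0, T[) (phi s * derive1n 2 psi s) =
  \int[mu]_(s in `]0, T[) (g s * psi s).

(* The test function [sum_i c_i (s - q_i)_+], with mollified positive parts, is
   compactly supported because [sum_i c_i] and [sum_i c_i q_i] vanish; its second
   derivative approximates [sum_i c_i delta_{q_i}].  The nodes [q_i] are the [p_i]
   moved slightly towards the midpoint of [A, B], so that the support stays
   inside ]A, B[ even when [A = 0] or [B = T]. *)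
Lemma weighted_point_values_bound (A B : R) m (c p : 'I_m -> R) :
  0 <= A -> A < B -> B <= T -> (forall i, A <= p i <= B) ->
  \sum_i c i = 0 -> \sum_i c i * p i = 0 ->
  `|\sum_i c i * phi (p i)| <=
    (\sum_i `|c i|) * (B - A) * \int[mu]_(s in `]A, B[) G s.
Proof.
move=> A0 AB BT pAB c0 cp0; have K0 : 0 < B - A by rewrite subr_gt0.
have S0 : 0 <= \sum_i `|c i| by exact: sumr_ge0.
apply/ler_addgt0Pr => e e0.
pose e1 := e / (\sum_i `|c i| + 1).
have e10 : 0 < e1 by rewrite divr_gt0// ltr_wpDl.
near (0 : R)^'+ => h.
have h0 : 0 < h by near: h; exact: nbhs_right_gt.
have hK : h < (B - A) / 4 by near: h; apply: nbhs_right_lt; rewrite divr_gt0.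
(* A contraction towards the midpoint whose ratio moves the endpoints [A] and [B] by exactly
   [2 * h], leaving room [h] beyond the half-width of each bump. Being affine, it preserves the
   vanishing of both moments; [hK] keeps the coefficient at most 1. *)
pose q i := p i + 4 * h / (B - A) * ((A + B) / 2 - p i).
have h1 : 0 <= 4 * h / (B - A) <= 1.
  rewrite divr_ge0 ?(ltW K0) ?mulr_ge0 ?(ltW h0)//=.
  by rewrite ler_pdivrMr//; lra.
have hE : 4 * h / (B - A) * (B - A) = 4 * h by rewrite divfK// gt_eqF.
have qp i : `|q i - p i| <= 2 * h.
  have /andP[? ?] := pAB i; have /andP[? ?] := h1.
  rewrite /q ler_norml; move: hE h1; set r := 4 * h / (B - A) => hE h1.
  by apply/andP; split; nra.
have qAB i : A + 2 * h <= q i <= B - 2 * h.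
  have /andP[? ?] := pAB i; have /andP[? ?] := h1.
  rewrite /q; move: hE h1; set r := 4 * h / (B - A) => hE h1.
  by apply/andP; split; nra.
have cq0 : \sum_i c i * q i = 0.
  transitivity (\sum_i ((1 - 4 * h / (B - A)) * (c i * p i)
                 + (4 * h / (B - A) * ((A + B) / 2)) * c i)).
    by apply: eq_bigr => i _; rewrite /q; ring.
  by rewrite big_split /= -!mulr_sumr c0 cp0 !mulr0 addr0.
pose psi s := \sum_i c i * ramp_at h (q i) s.
have psi_out s : s < A + h \/ B - h < s -> psi s = 0.
  move=> [sA|sB].
    rewrite /psi big1// => i _; rewrite ramp_at_le ?mulr0//.
    by have /andP[? ?] := qAB i; lra.
  rewrite /psi (eq_bigr (fun i => s * c i - c i * q i)).
    by rewrite sumrB -mulr_sumr c0 cq0 mulr0 subrr.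
  move=> i _; rewrite ramp_at_ge; [by ring|exact: h0|].
  by have /andP[? ?] := qAB i; lra.
have psi_test : time_test_function T psi.
  split.
    apply: ntimes_derivableP => n; apply: ntimes_derivable_sum => i.
    apply: ntimes_derivableM; first exact: ntimes_derivable_cst.
    exact: ntimes_derivable_ramp_at.
  exists `[A + h, B - h]%classic; split; first exact: segment_compact.
    by move=> x /=; rewrite !in_itv /= => /andP[? ?]; apply/andP; split; lra.
  move=> x /= xAB; apply: psi_out.
  case: (ltP x (A + h)) => xA; [by left|right].
  rewrite ltNge; apply/negP => xB; apply: xAB.
  by rewrite in_itv /= xA xB.
have psi2 : derive1n 2 psi = fun s => \sum_i c i * ramp_bump h (q i) s.
  rewrite /psi (derive1n_lincomb 2 c); last first.
    by move=> i k; exact: ntimes_derivable_ramp_at.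
  by apply/funext => s; apply: eq_bigr => i _; rewrite derive1n2_ramp_at.
have psiK s : A <= s <= B -> `|psi s| <= (\sum_i `|c i|) * (B - A).
  move=> /andP[sA sB]; rewrite (le_trans (ler_norm_sum _ _ _))// mulr_suml.
  apply: ler_sum => i _; rewrite normrM ler_wpM2l//.
  rewrite (le_trans (ler_norm_ramp_at _ _ _))//.
  have /andP[? ?] := qAB i.
  by rewrite ler_norml; apply/andP; split; lra.
have lhs : \int[mu]_(s in `]0, T[) (phi s * derive1n 2 psi s) =
    \sum_i c i * \int[mu]_(s in `]0, T[) (phi s * ramp_bump h (q i) s).
  rewrite psi2; under eq_Rintegral => x _.
    by rewrite mulr_sumr; under eq_bigr do rewrite mulrCA; over.
  apply: (Rintegral_lincomb _ _ _).2 => //.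
  by move=> i; apply: integrable_phiM; exact: continuous_ramp_bump.
have rhs : `|\int[mu]_(s in `]0, T[) (g s * psi s)| <=
    (\sum_i `|c i|) * (B - A) * \int[mu]_(s in `]A, B[) G s.
  have sub : `]A, B[%classic `<=` `]0, T[%classic.
    by move=> x /=; rewrite !in_itv /= => /andP[? ?]; apply/andP; split; lra.
  have -> : \int[mu]_(s in `]0, T[) (g s * psi s) =
      \int[mu]_(s in `]A, B[) (g s * psi s).
    apply: (@Rintegral_setS _ _ R mu _ _ (fun s => g s * psi s) sub) => x _ /= xAB.
    rewrite psi_out ?mulr0//.
    case: (ltP x (A + h)) => xA; [by left|right].
    rewrite ltNge; apply/negP => xB; apply: xAB.
    by rewrite in_itv /=; apply/andP; split; lra.
  have iGAB : mu.-integrable `]A, B[ (EFin \o G) by apply: integrableS iG.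
  pose K := (\sum_i `|c i|) * (B - A).
  have K1 : 0 <= K by rewrite mulr_ge0// ltW.
  have iKG : mu.-integrable `]A, B[ (EFin \o (fun s => K * G s)).
    have mAB : measurable (`]A, B[%classic : set (measurableTypeR R)) by [].
    by have := integrableZl mAB K iGAB.
  have bound x : `]A, B[%classic x -> `|g x * psi x| <= K * G x.
    move=> xAB; rewrite normrM mulrC ler_pM//; last exact/gG/sub.
    by apply: psiK; move: xAB => /=; rewrite in_itv /= => /andP[/ltW -> /ltW ->].
  have cpsi : continuous psi.
    apply: (@is_derive_continuous _ _ (derive1 psi)).
    apply: ntimes_derivable_is_derive.
    apply: ntimes_derivable_sum => i.
    apply: ntimes_derivableM; first exact: ntimes_derivable_cst.
    exact: ntimes_derivable_ramp_at.
  have igp : mu.-integrable `]A, B[ (EFin \o (fun s => g s * psi s)).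
    apply: le_integrable iKG => //.
      apply/measurable_EFinP; apply: measurable_funM.
        exact: measurable_funS mg.
      by apply: measurable_funTS; exact: continuous_measurable_fun.
    move=> x xAB /=; rewrite lee_fin (le_trans (bound _ xAB))// ler_norm//.
  rewrite (le_trans (le_normr_Rintegral _ igp))// -/K -RintegralZl//.
  apply: le_Rintegral => //; exact: integrable_norm.
have close i : `|\int[mu]_(s in `]0, T[) (phi s * ramp_bump h (q i) s) - phi (p i)|
    <= e1.
  have /andP[? ?] := qAB i.
  (* The centre is generalized because [q i] itself depends on [h]; the finitely many indices share
     one admissible [h]. *)
  have : forall i, forall q, `|q - p i| <= 2 * h -> h < q -> q + h < T ->
    `|\int[mu]_(s in `]0, T[) (phi s * ramp_bump h q s) - phi (p i)| <= e1.
    near: h; apply: filter_forall => j; apply: ramp_bump_approx => //.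
    by have /andP[? ?] := pAB j; apply/andP; split; lra.
  by apply => //; lra.
rewrite -weak_phi// lhs in rhs.
pose I i := \int[mu]_(s in `]0, T[) (phi s * ramp_bump h (q i) s).
have -> : \sum_i c i * phi (p i) =
    \sum_i c i * I i - \sum_i c i * (I i - phi (p i)).
  by rewrite -sumrB; apply: eq_bigr => i _; ring.
rewrite (le_trans (ler_normB _ _))// lerD//.
rewrite (le_trans (ler_norm_sum _ _ _))//.
apply: (@le_trans _ _ (\sum_i `|c i| * e1)).
  by apply: ler_sum => i _; rewrite normrM ler_wpM2l//; exact: close.
rewrite -mulr_suml /e1 mulrA ler_pdivrMr ?ltr_wpDl// mulrC.
by rewrite ler_wpM2l ?(ltW e0)// lerDl.
Unshelve. all: by end_near. Qed.

End weighted_point_values.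

(** * The DLN energy identity *)

Lemma mdot_suml (R : realType) m n k (c : 'I_k -> R) (A : 'I_k -> 'M[R]_(m, n))
    (B : 'M[R]_(m, n)) :
  mdot (\sum_i c i *: A i) B = \sum_i c i * mdot (A i) B.
Proof.
elim: k c A => [|k IH] c A.
  rewrite !big_ord0 /mdot big1// => i _; rewrite big1// => j _.
  by rewrite mxE mul0r.
by rewrite !big_ord_recl mdotDl mdotZl IH.
Qed.

Section bilinearity.
Variables (R : realType) (d : nat) (Omega : set 'rV[R]_d).
Hypothesis mO : measurable (Omega : set (Rd R d)).
Hypothesis fO : (leb (Omega : set (Rd R d)) < +oo)%E.

Lemma inner_lincomb m n k (a b : 'I_k -> R) (U : 'I_k -> 'rV[R]_d -> 'M[R]_(m, n)) :
  (forall i, LpM Omega 3 (U i)) ->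
  inner Omega (fun x => \sum_i a i *: U i x) (fun x => \sum_j b j *: U j x) =
  \sum_i a i * \sum_j b j * inner Omega (U i) (U j).
Proof.
move=> LU; have int i j := integrable_mdot mO fO (LU i) (LU j).
have [I E] : (forall i, leb.-integrable (Omega : set (Rd R d))
      (EFin \o (fun x => \sum_j b j * mdot (U i x) (U j x)))) /\
    (forall i, \int[leb]_(x in (Omega : set (Rd R d)))
      (\sum_j b j * mdot (U i x) (U j x)) = \sum_j b j * inner Omega (U i) (U j)).
  split=> i; have := @Rintegral_lincomb _ _ R leb (Omega : set (Rd R d)) k b
    (fun j x => mdot (U i x) (U j x)) mO (int i); by case.
rewrite /inner; under eq_Rintegral => x _.
  rewrite mdot_suml; under eq_bigr => i _ do rewrite mdotC mdot_suml.
  under eq_bigr => i _ do under eq_bigr => j _ do rewrite mdotC.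
  over.
rewrite (@Rintegral_lincomb _ _ R leb (Omega : set (Rd R d)) k a
  (fun i x => \sum_j b j * mdot (U i x) (U j x)) mO I).2.
by apply: eq_bigr => i _; rewrite E.
Qed.

Lemma innerZl m n c (U V : 'rV[R]_d -> 'M[R]_(m, n)) :
  LpM Omega 3 U -> LpM Omega 3 V ->
  inner Omega (fun x => c *: U x) V = c * inner Omega U V.
Proof.
move=> LU LV; rewrite /inner; under eq_Rintegral do rewrite mdotZl.
by rewrite RintegralZl//; exact: integrable_mdot.
Qed.

End bilinearity.

Section dln_algebra.
Variable R : realType.
Implicit Types theta eps : R.

Lemma dln_denom_gt0 theta eps : 0 <= theta <= 1 -> -1 < eps < 1 ->
  0 < 1 + eps * theta.
Proof. by move=> /andP[? ?] /andP[? ?]; nra. Qed.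

Lemma dln_lambda_sqr theta eps : 0 <= theta <= 1 ->
  (Num.sqrt (theta * (1 - theta ^+ 2)) / (Num.sqrt 2 * (1 + eps * theta))) ^+ 2
  = theta * (1 - theta ^+ 2) / (2 * (1 + eps * theta) ^+ 2).
Proof.
move=> /andP[t0 t1]; rewrite expr_div_n exprMn sqr_sqrtr; last by rewrite mulr_ge0//; nra.
by rewrite sqr_sqrtr.
Qed.

(** [g] plays the role of the Gram matrix of three successive iterates, so one identity serves both
    the values and the gradients. The square root in the lambda coefficients enters only through its
    square, after which the identity is rational in [theta] and [eps]. *)
Lemma dln_G_stability theta eps (g : nat -> nat -> R) :
  0 <= theta <= 1 -> -1 < eps < 1 -> (forall i j, g i j = g j i) ->
  \sum_(i < 3) dln_alpha theta i * \sum_(j < 3) dln_beta theta eps j * g i j =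
  (1 + theta) / 4 * g 2 2 + (1 - theta) / 4 * g 1 1
  - ((1 + theta) / 4 * g 1 1 + (1 - theta) / 4 * g 0 0)
  + \sum_(i < 3) dln_lambda theta eps i
      * \sum_(j < 3) dln_lambda theta eps j * g i j.
Proof.
move=> th e1 gC; have := dln_lambda_sqr eps th; have D0 := dln_denom_gt0 th e1.
rewrite !big_ord_recl !big_ord0 /= /bump /= /dln_lambda.
set L := _ / (Num.sqrt 2 * _) => L2.
rewrite (gC 1 0) (gC 2 0) (gC 2 1).
transitivity ((1 + theta) / 4 * g 2 2 + (1 - theta) / 4 * g 1 1 -
   ((1 + theta) / 4 * g 1 1 + (1 - theta) / 4 * g 0 0) +
   L ^+ 2 * (((1 + eps) / 2) ^+ 2 * g 0 0 + g 1 1 + ((1 - eps) / 2) ^+ 2 * g 2 2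
     - (1 + eps) * g 0 1 - (1 - eps) * g 1 2
     + (1 + eps) * (1 - eps) / 2 * g 0 2)); last first.
  by field.
rewrite L2 /dln_alpha /dln_beta /=; field.
by rewrite gt_eqF.
Qed.

End dln_algebra.

Section stencil_components.
Variables (R : realType) (d : nat).

Lemma stencil_fst (c : nat -> R) (w : nat -> field_grad R d) n :
  (stencil c w n).1 = (fun x => \sum_(l < 3) c l *: (w (n.-1 + l)%N).1 x).
Proof.
by apply/funext => x; rewrite /stencil !big_ord_recl !big_ord0.
Qed.

Lemma stencil_snd (c : nat -> R) (w : nat -> field_grad R d) n :
  (stencil c w n).2 = (fun x => \sum_(l < 3) c l *: (w (n.-1 + l)%N).2 x).
Proof.
by apply/funext => x; rewrite /stencil !big_ord_recl !big_ord0.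
Qed.

Lemma stencil_closed (V : lmodType R) (A : set V) (c : nat -> R) (w : nat -> V) n :
  A 0 -> (forall a u v, A u -> A v -> A (a *: u + v)) ->
  (forall l, (l < 3)%N -> A (w (n.-1 + l)%N)) -> A (stencil c w n).
Proof.
move=> A0 AD Aw; rewrite /stencil; elim/big_ind: _ => //.
  by move=> u v Au Av; rewrite -[u]scale1r; exact: AD.
by move=> l _; rewrite -[_ *: _]addr0; apply: AD => //; exact: Aw.
Qed.

End stencil_components.

Section energy_step.
Variables (R : realType) (d : nat) (Omega : set 'rV[R]_d).
Hypothesis mO : measurable (Omega : set (Rd R d)).
Hypothesis fO : (leb (Omega : set (Rd R d)) < +oo)%E.

Definition energy (kappa : R) (u : field_grad R d) : R :=
  l2norm Omega u.1 ^+ 2 + kappa * l2norm Omega u.2 ^+ 2.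

(** The squared G-norm of two successive iterates, with G the diagonal matrix of (1 + theta)/4 and
    (1 - theta)/4. It does not involve the time steps, so its increments telescope on any grid. *)
Definition dln_energy (theta kappa : R) (u v : field_grad R d) : R :=
  (1 + theta) / 4 * energy kappa u + (1 - theta) / 4 * energy kappa v.

Lemma stencil_G_stability theta eps m n (U : nat -> 'rV[R]_d -> 'M[R]_(m, n)) :
  0 <= theta <= 1 -> -1 < eps < 1 -> (forall i, (i < 3)%N -> LpM Omega 3 (U i)) ->
  inner Omega (fun x => \sum_(l < 3) dln_alpha theta l *: U l x)
              (fun x => \sum_(l < 3) dln_beta theta eps l *: U l x) =
  (1 + theta) / 4 * l2norm Omega (U 2) ^+ 2
  + (1 - theta) / 4 * l2norm Omega (U 1) ^+ 2
  - ((1 + theta) / 4 * l2norm Omega (U 1) ^+ 2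
     + (1 - theta) / 4 * l2norm Omega (U 0) ^+ 2)
  + l2norm Omega (fun x => \sum_(l < 3) dln_lambda theta eps l *: U l x) ^+ 2.
Proof.
move=> th e1 LU; rewrite !l2norm_sqr.
rewrite (inner_lincomb mO fO (fun i : 'I_3 => dln_alpha theta i)
  (fun i : 'I_3 => dln_beta theta eps i) (U := fun i : 'I_3 => U i)); last first.
  by move=> i; exact: LU.
rewrite (inner_lincomb mO fO (fun i : 'I_3 => dln_lambda theta eps i)
  (fun i : 'I_3 => dln_lambda theta eps i) (U := fun i : 'I_3 => U i)); last first.
  by move=> i; exact: LU.
rewrite (dln_G_stability (g := fun i j => inner Omega (U i) (U j)) th e1)//.
by move=> i j; exact: innerC.
Qed.

Variables (theta nu mu Cs delta gamma : R).
Variables (Xh : set (field_grad R d)) (Qh : set ('rV[R]_d -> R^o)).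
Variables (t : nat -> R^o) (f : R -> functional R d).
Variables (w : nat -> field_grad R d) (q : nat -> 'rV[R]_d -> R^o) (m : nat).
Hypothesis th : 0 <= theta <= 1.
Hypothesis hX : findim_subspace Xh.
Hypothesis XhX : Xh `<=` spaceX Omega.
Hypothesis hQ : findim_subspace Qh.
Hypothesis eps1 : -1 < eps_ t m.+1 < 1.
Hypothesis khat0 : khat theta t m.+1 != 0.
Hypothesis Xw : forall l, (l < 3)%N -> Xh (w (m + l)%N).
Hypothesis Qq : forall l, (l < 3)%N -> Qh (q (m + l)%N).

Lemma stencil_Xh (c : nat -> R) : Xh (stencil c w m.+1).
Proof. by have [? ? _] := hX; exact: stencil_closed. Qed.

Let kappa := Cs ^+ 4 * delta ^+ 2 / mu ^+ 2.
Let wb := beta_avg theta t w m.+1.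
Let wl := stencil (dln_lambda theta (eps_ t m.+1)) w m.+1.

(** The momentum equation at [v = wb], multiplied by [khat], with G-stability applied to the values
    and, with weight [kappa], to the gradients. The index is [m.+1], so that the predecessor in
    [stencil] is [m]. *)
Lemma dln_energy_identity :
  dln_momentum Omega Xh theta nu mu Cs delta gamma t f w q m.+1 ->
  dln_continuity Omega Qh theta t w m.+1 ->
  dln_energy theta kappa (w m.+2) (w m.+1)
  - dln_energy theta kappa (w m.+1) (w m) + energy kappa wl
  + khat theta t m.+1 * (nu * l2norm Omega wb.2 ^+ 2
                         + gamma * l2norm0 Omega (div wb) ^+ 2)
  + khat theta t m.+1 * \int[leb]_(x in (Omega : set (Rd R d)))
      ((Cs * delta) ^+ 2 * enorm (wb.2 x) * enorm (wb.2 x) ^+ 2)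
  = khat theta t m.+1 * beta_avg theta t (f \o t) m.+1 wb.1.
Proof.
move=> mom con; have Xwb : Xh wb by exact: stencil_Xh.
have Xdw := stencil_Xh (dln_alpha theta).
have [Lb1 Lb2 _ _] := XhX Xwb; have [Ld1 Ld2 _ _] := XhX Xdw.
have L1 i : (i < 3)%N -> LpM Omega 3 (w (m + i)%N).1.
  by move=> /Xw/XhX[].
have L2 i : (i < 3)%N -> LpM Omega 3 (w (m + i)%N).2.
  by move=> /Xw/XhX[].
(* At [v = wb] the two halves of [bstar] are the same integral. *)
have := mom _ Xwb; rewrite /bstar subrr addr0.
rewrite (innerZl mO fO _ Ld1 Lb1) (innerZl mO fO _ Ld2 Lb2).
have -> : inner0 Omega (beta_avg theta t q m.+1) (div wb) = 0.
  have [Q0 QD _] := hQ; rewrite inner0C con//.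
  exact: (@stencil_closed _ _ Qh _ q m.+1 Q0 QD Qq).
rewrite subr0.
have -> : inner Omega (fun x => ((Cs * delta) ^+ 2 * enorm (wb.2 x)) *: wb.2 x) wb.2 =
    \int[leb]_(x in (Omega : set (Rd R d)))
      ((Cs * delta) ^+ 2 * enorm (wb.2 x) * enorm (wb.2 x) ^+ 2).
  by apply: eq_Rintegral => x _; rewrite mdotZl enorm_sqr.
have G1 := stencil_G_stability th eps1 L1.
have G2 := stencil_G_stability th eps1 L2.
rewrite -(stencil_fst (dln_alpha theta) w m.+1)
  -(stencil_fst (dln_beta theta (eps_ t m.+1)) w m.+1)
  -(stencil_fst (dln_lambda theta (eps_ t m.+1)) w m.+1) addn0 addn1 addn2 in G1.
rewrite -(stencil_snd (dln_alpha theta) w m.+1)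
  -(stencil_snd (dln_beta theta (eps_ t m.+1)) w m.+1)
  -(stencil_snd (dln_lambda theta (eps_ t m.+1)) w m.+1) addn0 addn1 addn2 in G2.
rewrite -(l2norm_sqr _ wb.2) -(l2norm0_sqr _ (div wb)) {}G1 {}G2 => <-.
rewrite /dln_energy /energy /wl /kappa.
move: (l2norm _ _) (l2norm _ _) (l2norm _ _) => a b c.
move: (l2norm _ _) (l2norm _ _) (l2norm _ _) => a' b' c'.
move: (l2norm _ _) (l2norm _ _) (l2norm _ _) => a'' b'' c''.
move: (l2norm0 _ _) (Rintegral _ _ _) (khat _ _ _) khat0 => D I K K0.
move: (Cs ^+ 4 * _ / _) => k; field; exact: K0.
Qed.

End energy_step.

(** * Functions with values in the dual space *)

Section functional_valued_functions.
Variables (R : realType) (d : nat) (Omega : set 'rV[R]_d).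
Local Notation mu := (@lebesgue_measure R).

(** [Phi] is arbitrary, linear or not: the indicators are split off one at a time, according to
    whether [r] lies in the set, and the offset [F0] absorbs the chosen value so that the induction
    goes through. The sets may overlap. *)
Lemma measurable_fun_simple (V : lmodType R) (Phi : V -> R) (m : nat)
    (A : 'I_m -> set R) (F : 'I_m -> V) (F0 : V) :
  (forall i, measurable (A i)) ->
  measurable_fun [set: R] (fun r => Phi (F0 + \sum_i \1_(A i) r *: F i)).
Proof.
elim: m A F F0 => [|m IH] A F F0 mA.
  by under eq_fun do rewrite big_ord0; exact: measurable_cst.
under eq_fun do rewrite big_ord_recl addrA.
pose rest r := \sum_(i < m) \1_(A (lift ord0 i)) r *: F (lift ord0 i).
have -> : (fun r => Phi (F0 + \1_(A ord0) r *: F ord0 + rest r)) =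
  (fun r => \1_(A ord0) r * Phi (F0 + F ord0 + rest r)
            + (1 - \1_(A ord0) r) * Phi (F0 + rest r)).
  apply/funext => r; rewrite indicE; case: (r \in A ord0) => /=.
    by rewrite scale1r mul1r subrr mul0r addr0.
  by rewrite scale0r mul0r subr0 mul1r addr0 add0r.
have mI : measurable_fun [set: R] (\1_(A ord0) : R -> R) by exact: measurable_indic.
apply: measurable_funD; apply: measurable_funM => //.
- exact: (IH (fun i => A (lift ord0 i)) (fun i => F (lift ord0 i))).
- exact: measurable_funB.
- exact: (IH (fun i => A (lift ord0 i)) (fun i => F (lift ord0 i))).
Qed.

Lemma measurable_fun_simple_dual (s : R -> functional R d) (Phi : functional R d -> R) :
  simple_dual Omega s -> measurable_fun [set: R] (fun r => Phi (s r)).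
Proof.
move=> [m [A [F [mA _ sE]]]].
have := measurable_fun_simple Phi F 0 mA.
by under eq_fun do rewrite add0r -sE.
Qed.

Lemma simple_dualX (s : R -> functional R d) r :
  simple_dual Omega s -> dualX Omega (s r).
Proof.
move=> [m [A [F [_ dF ->]]]]; elim/big_ind: _.
- exact: dualX0.
- by move=> x y; exact: dualXD.
- by move=> i _; exact: dualXZ.
Qed.

Section strongly_measurable.
Variables (D : set R) (g : R -> functional R d).
Hypothesis mg : strongly_measurable Omega D g.
Hypothesis dg : forall r, D r -> dualX Omega (g r).

(** A pointwise limit of the norms of the approximating simple functions, by the reverse triangle
    inequality. *)
Lemma measurable_fun_dual_norm : measurable_fun D (fun r => dual_norm Omega (g r)).
Proof.
have [s [ss sg]] := mg.
apply: (@measurable_fun_cvg _ _ _ D (fun n r => dual_norm Omega (s n r))).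
  by move=> n; apply: measurable_funTS; exact: measurable_fun_simple_dual.
move=> r Dr; apply/cvgrPdist_le => e e0.
have := sg _ Dr; move/cvgrPdist_le => /(_ _ e0); apply: filterS => n.
rewrite sub0r normrN => /(le_trans (ler_norm _)); apply: le_trans.
rewrite distrC; apply: dual_norm_dist; last exact: dg.
exact: simple_dualX.
Qed.

Lemma measurable_fun_dual_apply u : spaceX Omega u ->
  measurable_fun D (fun r => g r u.1).
Proof.
move=> Xu; have [s [ss sg]] := mg.
apply: (@measurable_fun_cvg _ _ _ D (fun n r => s n r u.1)).
  move=> n; apply: measurable_funTS.
  exact: (@measurable_fun_simple_dual _ (fun F => F u.1)).
move=> r Dr; apply/cvgrPdist_le => e e0.
have e1 : 0 < e / (l2norm Omega u.2 + 1).
  by rewrite divr_gt0// ltr_wpDl// l2norm_ge0.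
have := sg _ Dr; move/cvgrPdist_le => /(_ _ e1); apply: filterS => n.
rewrite sub0r normrN => /(le_trans (ler_norm _)) sge.
have dsg : dualX Omega (s n r - g r) by apply: dualXB; [exact: simple_dualX|exact: dg].
rewrite distrC -[_ - _]/((s n r - g r) u.1).
rewrite (le_trans (dual_norm_bound dsg Xu))//.
rewrite (le_trans (ler_wpM2r (l2norm_ge0 _ _) sge))//.
rewrite mulrAC ler_pdivrMr ?ltr_wpDl ?l2norm_ge0//.
by rewrite ler_wpM2l ?(ltW e0)// lerDl.
Qed.

End strongly_measurable.

(** The first power is dominated through [a <= 1 + a^2], the interval having finite length. *)
Lemma L2X'_dual_norm_integrable (T : R) (g : R -> functional R d) :
  L2X' Omega T g ->
  mu.-integrable `]0, T[ (EFin \o (fun r => dual_norm Omega (g r) ^+ 2)) /\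
  mu.-integrable `]0, T[ (EFin \o (fun r => dual_norm Omega (g r))).
Proof.
move=> [dg mg fin].
have mn := measurable_fun_dual_norm mg dg.
have i2 : mu.-integrable `]0, T[ (EFin \o (fun r => dual_norm Omega (g r) ^+ 2)).
  apply/integrableP; split.
    by apply/measurable_EFinP; exact: measurable_funX.
  under eq_integral => r _ do rewrite /= ger0_norm ?sqr_ge0//.
  exact: fin.
split=> //.
have i1 : mu.-integrable `]0, T[ (EFin \o (fun r => 1 + dual_norm Omega (g r) ^+ 2)).
  have ic : mu.-integrable `]0, T[ (EFin \o (fun _ : R => 1)).
    have : {within `[0, T], continuous (fun _ : R => 1 : R^o)}.
      by apply: continuous_subspaceT => x; exact: cst_continuous.
    move/(continuous_compact_integrable (@segment_compact _ 0 T)).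
    by apply: integrableS => //; exact: subset_itv_oo_cc.
  have mT : measurable (`]0, T[%classic : set (measurableTypeR R)) by [].
  by have := integrableD mT ic i2.
apply: le_integrable i1 => //; first exact/measurable_EFinP.
move=> r _ /=; rewrite lee_fin [leRHS]ger0_norm ?addr_ge0 ?sqr_ge0//.
rewrite -[dual_norm _ _ ^+ 2]real_normK ?num_real//.
have := normr_ge0 (dual_norm Omega (g r)); move: `|_| => a a0.
by have := sqr_ge0 (a - 1); nra.
Qed.

End functional_valued_functions.

(** * Consistency of the DLN averages *)

Section dln_coefficients.
Variable R : realType.
Implicit Types theta eps : R.

(* At [theta = 1] this is 3, because [0 / 0 = 0]; the vanishing numerator then
   makes the estimate below true there as well. *)
Definition dln_beta_bound theta : R :=
  3 * (1 + (1 - theta ^+ 2) / (1 - theta) ^+ 2).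

(** Since [eps > -1], the quantity [1 + eps * theta] is at least [1 - theta] whatever the ratio of
    the steps; this is how the constant comes to depend on [theta] alone. *)
Lemma dln_ratio_bounds theta eps : 0 <= theta <= 1 -> -1 < eps < 1 ->
  0 <= (1 - theta ^+ 2) / (1 + eps * theta) ^+ 2 <=
    (1 - theta ^+ 2) / (1 - theta) ^+ 2.
Proof.
move=> th e1; have D0 := dln_denom_gt0 th e1; move: (th) (e1) => /andP[t0 t1] /andP[? ?].
have n0 : 0 <= 1 - theta ^+ 2 by nra.
rewrite divr_ge0 ?sqr_ge0//=.
have [->|tn1] := eqVneq theta 1; first by rewrite expr1n subrr !mul0r.
have t1' : 0 < 1 - theta by rewrite subr_gt0 lt_neqAle tn1.
rewrite ler_wpM2l// lef_pV2 ?posrE ?exprn_gt0//.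
rewrite ler_pXn2r ?nnegrE ?(ltW t1') ?(ltW D0)//.
by have : 0 <= theta * (1 + eps) by [rewrite mulr_ge0//; lra]; lra.
Qed.

Lemma dln_beta_bound_gt0 theta : 0 <= theta <= 1 -> 0 < dln_beta_bound theta.
Proof.
move=> th; rewrite /dln_beta_bound.
have := @dln_ratio_bounds theta 0 th; rewrite ltrN10 ltr01 => /(_ isT) /andP[a b].
by have := le_trans a b; lra.
Qed.

Lemma dln_beta_sum1 theta eps :
  dln_beta theta eps 0 + dln_beta theta eps 1 + dln_beta theta eps 2 = 1.
Proof. by rewrite /dln_beta; move: (_ / _) (eps ^+ 2 * _) => r s; field. Qed.

(** The summand 1 is the weight of the value at the averaged time. With [r0] the ratio in
    [dln_beta_bound], the three beta weights are at most 1/4, 1/2 and 1/2 times [1 + r0], so the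
    constant 3 leaves room. *)
Lemma dln_beta_abs_sum theta eps : 0 <= theta <= 1 -> -1 < eps < 1 ->
  `|dln_beta theta eps 0| + `|dln_beta theta eps 1| + `|dln_beta theta eps 2| + 1
    <= dln_beta_bound theta.
Proof.
move=> th e1; have := dln_ratio_bounds th e1; rewrite /dln_beta_bound /dln_beta.
rewrite -[theta * _ / _]mulrA.
move: (_ / (1 + _) ^+ 2) (_ / (1 - theta) ^+ 2) th e1 => r r0.
move=> /andP[t0 t1] /andP[e0 e1] /andP[rge0 rr0].
have e20 := sqr_ge0 eps; have e21 : eps ^+ 2 <= 1.
  by rewrite -real_normK ?num_real// exprn_ile1// ler_norml; apply/andP; split; lra.
have tr1 : theta * r <= r0 by rewrite (le_trans _ rr0)// ler_piMl.
have tr0 : 0 <= theta * r by rewrite mulr_ge0.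
have : 0 <= eps ^+ 2 * (theta * r) by rewrite mulr_ge0.
have : eps ^+ 2 * (theta * r) <= r0 by rewrite (le_trans _ tr1)// ler_piMl.
move: (eps ^+ 2 * _) => s s1 s0.
have b0 : `|4^-1 * (1 + r - s - theta)| <= (1 + r0) / 4.
  by rewrite ler_norml; apply/andP; split; lra.
have b1 : `|2^-1 * (1 - r)| <= (1 + r0) / 2.
  by rewrite ler_norml; apply/andP; split; lra.
have b2 : `|4^-1 * (1 + r + s + theta)| <= (2 + 2 * r0) / 4.
  by rewrite ler_norml; apply/andP; split; lra.
lra.
Qed.

(** With [K] the window length, the two products by [K] are the current and the previous step, and
    the middle term is the offset of the averaged time from the middle node. The middle beta weight
    can be negative, so convexity does not apply; the offset is simplified to a single fraction
    instead. *)
Lemma dln_time_mem theta eps K : 0 <= theta <= 1 -> -1 < eps < 1 -> 0 < K ->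
  - ((1 - eps) / 2 * K) <=
    dln_beta theta eps 2 * ((1 + eps) / 2 * K)
    - dln_beta theta eps 0 * ((1 - eps) / 2 * K)
  <= (1 + eps) / 2 * K.
Proof.
move=> th e1 K0; have D0 := dln_denom_gt0 th e1.
have -> : dln_beta theta eps 2 * ((1 + eps) / 2 * K)
    - dln_beta theta eps 0 * ((1 - eps) / 2 * K) =
    K / 4 * ((theta + 2 * eps + eps ^+ 2 * theta) / (1 + eps * theta)).
  by rewrite /dln_beta; field; rewrite gt_eqF.
have K4 : 0 < K / 4 by rewrite divr_gt0.
have -> : - ((1 - eps) / 2 * K) = K / 4 * (- 2 * (1 - eps)) by field.
have -> : (1 + eps) / 2 * K = K / 4 * (2 * (1 + eps)) by field.
move: th e1 => /andP[? ?] /andP[? ?].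
rewrite !ler_pM2l// ler_pdivlMr// ler_pdivrMr//.
by apply/andP; split; nra.
Qed.

Variable (t : nat -> R^o) (m : nat).
Hypotheses (t01 : t m < t m.+1) (t12 : t m.+1 < t m.+2).

Lemma eps_itv : -1 < eps_ t m.+1 < 1.
Proof.
suff H (x y z : R) : x < y -> y < z ->
    -1 < ((z - y) - (y - x)) / ((z - y) + (y - x)) < 1 by exact: H t01 t12.
move=> xy yz; have D0 : 0 < (z - y) + (y - x) by lra.
by rewrite ltr_pdivrMr ?ltr_pdivlMr//; apply/andP; split; lra.
Qed.

Lemma beta_avg_time_mem theta : 0 <= theta <= 1 ->
  t m <= beta_avg theta t t m.+1 <= t m.+2.
Proof.
move=> th; have e1 := eps_itv.
suff H (x y z eps : R) : x < y -> y < z -> -1 < eps < 1 ->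
    eps = ((z - y) - (y - x)) / ((z - y) + (y - x)) ->
    x <= dln_beta theta eps 0 * x + (dln_beta theta eps 1 * y
      + (dln_beta theta eps 2 * z + 0)) <= z.
  have := H _ _ _ _ t01 t12 e1 erefl.
  by rewrite /beta_avg /stencil !big_ord_recl big_ord0 /= /bump /= addn0 addn1 addn2.
move=> xy yz eps1 epsE; have K0 : 0 < z - x by lra.
have := dln_time_mem th eps1 K0; have := dln_beta_sum1 theta eps.
have -> : (1 + eps) / 2 * (z - x) = z - y.
  by rewrite epsE; field; rewrite gt_eqF//; lra.
have -> : (1 - eps) / 2 * (z - x) = y - x.
  by rewrite epsE; field; rewrite gt_eqF//; lra.
move: (dln_beta _ _ 0) (dln_beta _ _ 1) (dln_beta _ _ 2) => b0 b1 b2 b /andP[h1 h2].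
have -> : b1 = 1 - b0 - b2 by lra.
by apply/andP; split; lra.
Qed.

End dln_coefficients.

(** * Chaining of open intervals and the Cauchy-Schwarz inequality *)

Section open_interval_integrals.
Variable R : realType.
Local Notation mu := (@lebesgue_measure R).

(** An inequality by monotonicity is enough, the point [b] being left out of both intervals; [a = b]
    is allowed so that a chain can start at time 0. *)
Lemma Rintegral_itv_oo_chain (G : R -> R) (a b c : R) :
  a <= b -> b < c -> (forall x, 0 <= G x) ->
  mu.-integrable `]a, c[ (EFin \o G) ->
  \int[mu]_(s in `]a, b[) G s + \int[mu]_(s in `]b, c[) G s <=
    \int[mu]_(s in `]a, c[) G s.
Proof.
move=> ab bc G0 iG.
have mU (x y : R) : measurable (`]x, y[%classic : set (measurableTypeR R)) by [].
have sub : `]a, b[%classic `|` `]b, c[%classic `<=` `]a, c[%classic.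
  by move=> x [] /=; rewrite !in_itv /= => /andP[? ?]; apply/andP; split; lra.
have iU : mu.-integrable (`]a, b[%classic `|` `]b, c[%classic) (EFin \o G).
  by apply: integrableS iG => //; exact: measurableU.
rewrite -(Rintegral_setU (mU a b) (mU b c) iU); last first.
  by rewrite disj_set_sym; apply/disj_setPS => x [] /=; rewrite !in_itv /=;
    move=> /andP[? ?] /andP[? ?]; lra.
rewrite /Rintegral fine_le//.
- by rewrite integrable_fin_num//; exact: measurableU.
- by rewrite integrable_fin_num.
apply: ge0_subset_integral => //.
- exact: measurableU.
- by apply: measurable_int iG.
- by move=> x _; rewrite lee_fin.
Qed.

(** The integral of [(G - l)^2] is nonnegative; taking for [l] the mean of [G] gives the
    inequality. *)
Lemma Rintegral_sqr_le (G : R -> R) (a b : R) : a < b ->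
  mu.-integrable `]a, b[ (EFin \o G) ->
  mu.-integrable `]a, b[ (EFin \o (fun s => G s ^+ 2)) ->
  (\int[mu]_(s in `]a, b[) G s) ^+ 2 <= (b - a) * \int[mu]_(s in `]a, b[) (G s ^+ 2).
Proof.
move=> ab i1 i2; have K0 : 0 < b - a by rewrite subr_gt0.
have mab : measurable (`]a, b[%classic : set (measurableTypeR R)) by [].
set I := Rintegral _ _ _; set J := Rintegral _ _ _.
pose l := I / (b - a).
have ic : mu.-integrable `]a, b[ (EFin \o (fun _ : R => l ^+ 2)).
  have : {within `[a, b], continuous (fun _ : R => l ^+ 2 : R^o)}.
    by apply: continuous_subspaceT => x; exact: cst_continuous.
  move/(continuous_compact_integrable (@segment_compact _ a b)).
  by apply: integrableS => //; exact: subset_itv_oo_cc.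
have iZ : mu.-integrable `]a, b[ (EFin \o (fun s => (- 2 * l) * G s)).
  by have := integrableZl mab (- 2 * l) i1.
have i3 : mu.-integrable `]a, b[ (EFin \o (fun s => G s ^+ 2 + - 2 * l * G s)).
  by have := integrableD mab i2 iZ.
have : 0 <= \int[mu]_(s in `]a, b[) ((G s ^+ 2 + - 2 * l * G s) + l ^+ 2).
  apply: Rintegral_ge0 => s _.
  by rewrite (_ : _ + _ = (G s - l) ^+ 2) ?sqr_ge0//; ring.
rewrite (RintegralD mab i3 ic) (RintegralD mab i2 iZ) (RintegralZl _ mab i1).
rewrite Rintegral_cst//= lebesgue_measure_itv/= lte_fin ab -EFinB /= -/I -/J.
have -> : J + - 2 * l * I + l ^+ 2 * (b - a) = J - I ^+ 2 / (b - a).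
  by rewrite /l; field; rewrite gt_eqF.
by rewrite subr_ge0 ler_pdivrMr// mulrC.
Qed.

End open_interval_integrals.

Section consistency.
Variables (R : realType) (d : nat) (Omega : set 'rV[R]_d) (T theta : R).
Variables (f ftt : R -> functional R d) (t : nat -> R^o) (m : nat).
Local Notation mu := (@lebesgue_measure R).
Hypothesis hf : body_force Omega T f ftt.
Hypothesis th : 0 <= theta <= 1.
Hypotheses (t01 : t m < t m.+1) (t12 : t m.+1 < t m.+2).
Hypotheses (t00 : 0 <= t m) (t2T : t m.+2 <= T).

Lemma body_force_continuous u : spaceX Omega u ->
  {within `[0, T], continuous (fun r => f r u.1 : R^o)}.
Proof.
have [df cf _ _] := hf => Xu; apply/subspace_continuousP => r rT.
apply/cvgrPdist_le => e e0.
have e1 : 0 < e / (l2norm Omega u.2 + 1).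
  by rewrite divr_gt0// ltr_wpDl// l2norm_ge0.
have := cf _ rT; move/cvgrPdist_le => /(_ _ e1).
rewrite !near_withinE; apply: filterS => s /[swap] sT /(_ sT).
rewrite sub0r normrN => /(le_trans (ler_norm _)) sr.
have dsr : dualX Omega (f s - f r) by apply: dualXB; exact: df.
rewrite distrC -[_ - _]/((f s - f r) u.1).
rewrite (le_trans (dual_norm_bound dsr Xu))//.
rewrite (le_trans (ler_wpM2r (l2norm_ge0 _ _) sr))//.
rewrite mulrAC ler_pdivrMr ?ltr_wpDl ?l2norm_ge0//.
by rewrite ler_wpM2l ?(ltW e0)// lerDl.
Qed.

(** The kernel estimate with four points: the three nodes with their beta weights and the averaged
    time with weight -1. The weights sum to 0 by [dln_beta_sum1], and the first moment vanishes by
    the definition of the averaged time. *)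
Lemma dln_consistency u : spaceX Omega u ->
  `|beta_avg theta t (f \o t) m.+1 u.1 - f (beta_avg theta t t m.+1) u.1| <=
    dln_beta_bound theta * (t m.+2 - t m)
    * \int[mu]_(s in `]t m, t m.+2[) dual_norm Omega (ftt s) * l2norm Omega u.2.
Proof.
move=> Xu; have [df cf L2 wf] := hf; have [dg mg _] := L2.
have [_ iG] := L2X'_dual_norm_integrable L2.
have e1 := eps_itv t01 t12.
have mtT : measurable (`]0, T[%classic : set (measurableTypeR R)) by [].
have mt2 : measurable (`]t m, t m.+2[%classic : set (measurableTypeR R)) by [].
have iGu : mu.-integrable `]0, T[
    (EFin \o (fun s => l2norm Omega u.2 * dual_norm Omega (ftt s))).
  by have := integrableZl mtT (l2norm Omega u.2) iG.
pose c (i : 'I_4) : R :=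
  if (i < 3)%N then dln_beta theta (eps_ t m.+1) i else - 1.
pose p (i : 'I_4) : R := if (i < 3)%N then t (m + i)%N else beta_avg theta t t m.+1.
have bE : beta_avg theta t t m.+1 = dln_beta theta (eps_ t m.+1) 0 * t m
    + (dln_beta theta (eps_ t m.+1) 1 * t m.+1
       + (dln_beta theta (eps_ t m.+1) 2 * t m.+2 + 0)).
  by rewrite /beta_avg /stencil !big_ord_recl big_ord0 /= /bump /= addn0 addn1 addn2.
have fE : beta_avg theta t (f \o t) m.+1 u.1 =
    dln_beta theta (eps_ t m.+1) 0 * f (t m) u.1
    + (dln_beta theta (eps_ t m.+1) 1 * f (t m.+1) u.1
       + (dln_beta theta (eps_ t m.+1) 2 * f (t m.+2) u.1 + 0)).
  by rewrite /beta_avg /stencil !big_ord_recl big_ord0 /= /bump /= addn0 addn1 addn2.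
have := @weighted_point_values_bound R T (fun r => f r u.1)
  (body_force_continuous Xu) (fun r => ftt r u.1)
  (fun r => l2norm Omega u.2 * dual_norm Omega (ftt r)).
move=> /(_ (measurable_fun_dual_apply mg dg Xu)).
have gG s : `]0, T[%classic s ->
    `|ftt s u.1| <= l2norm Omega u.2 * dual_norm Omega (ftt s).
  by move=> sT; rewrite mulrC; apply: dual_norm_bound => //; exact: dg.
move=> /(_ gG iGu (fun psi tpsi => wf psi tpsi u Xu)).
move=> /(_ (t m) (t m.+2) 4 c p t00 (lt_trans t01 t12) t2T).
have pm i : t m <= p i <= t m.+2.
  rewrite /p; case: ifP => [|_]; last exact: beta_avg_time_mem.
  case: i => -[|[|[|//]]] i4 _ /=; rewrite ?addn0 ?addn1 ?addn2.
  - by rewrite lexx ltW// (lt_trans t01).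
  - by rewrite !ltW.
  - by rewrite lexx ltW// (lt_trans t01).
have S1 := dln_beta_sum1 theta (eps_ t m.+1).
have c0 : \sum_i c i = 0.
  rewrite !big_ord_recl big_ord0 /c /= /bump /= addr0.
  by rewrite !addrA S1 subrr.
have cp0 : \sum_i c i * p i = 0.
  rewrite !big_ord_recl big_ord0 /c /p /= /bump /= addn0 addn1 addn2 bE.
  suff H (x y z : R) : x + (y + (z + (- 1 * (x + (y + (z + 0))) + 0))) = 0 by exact: H.
  by ring.
move=> /(_ pm c0 cp0).
have -> : \sum_i c i * f (p i) u.1 =
    beta_avg theta t (f \o t) m.+1 u.1 - f (beta_avg theta t t m.+1) u.1.
  rewrite fE !big_ord_recl big_ord0 /c /p /= /bump /= addn0 addn1 addn2.
  suff H (x y z v : R) : x + (y + (z + (- 1 * v + 0))) = x + (y + (z + 0)) - v.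
    exact: H.
  by ring.
move=> /le_trans; apply.
have iGS : mu.-integrable `]t m, t m.+2[ (EFin \o (fun s => dual_norm Omega (ftt s))).
  apply: integrableS iG => // x /=; rewrite !in_itv /= => /andP[x1 x2].
  by rewrite (le_lt_trans t00 x1) (lt_le_trans x2 t2T).
rewrite (RintegralZl _ mt2 iGS) mulrA mulrAC ler_wpM2r ?l2norm_ge0//.
rewrite ler_wpM2r//.
  apply: Rintegral_ge0 => s /=; rewrite in_itv /= => /andP[x1 x2].
  apply: dual_norm_ge0; apply: dg.
  by rewrite /= in_itv /= (le_lt_trans t00 x1) (lt_le_trans x2 t2T).
rewrite ler_wpM2r//; first by rewrite subr_ge0 ltW// (lt_trans t01).
rewrite !big_ord_recl big_ord0 /c /= /bump /= addr0 normrN1 !addrA.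
exact: dln_beta_abs_sum.
Qed.

End consistency.

(** * Summation over the time grid *)

(** Right minus left of the basic inequality is a sum of two squares divided by [2 * nu]. The factor
    [k] is enlarged to [K] only in the data terms; the [nu / 2] term keeps [k] so that it can be
    absorbed. *)
Lemma young_forcing (R : realFieldType) (nu k K F E Q g b : R) :
  0 < nu -> 0 <= k <= K -> 0 <= F -> 0 <= E -> E ^+ 2 <= Q ->
  b <= (F + E) * g ->
  k * b <= k * (nu / 2 * g ^+ 2) + nu^-1 * (K * F ^+ 2) + nu^-1 * (K * Q).
Proof.
move=> nu0 /andP[k0 kK] F0 E0 EQ bFE.
have h : (F + E) * g <= nu / 2 * g ^+ 2 + nu^-1 * (F ^+ 2 + E ^+ 2).
  rewrite -subr_ge0.
  have -> : nu / 2 * g ^+ 2 + nu^-1 * (F ^+ 2 + E ^+ 2) - (F + E) * g =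
      (2 * nu)^-1 * ((nu * g - (F + E)) ^+ 2 + (F - E) ^+ 2).
    by field; rewrite gt_eqF.
  by rewrite mulr_ge0 ?addr_ge0 ?sqr_ge0// invr_ge0 mulr_ge0// ltW.
rewrite (le_trans (ler_wpM2l k0 (le_trans bFE h)))//.
have h2 : k * (F ^+ 2 + E ^+ 2) <= K * F ^+ 2 + K * Q.
  by rewrite -mulrDr ler_pM ?addr_ge0 ?sqr_ge0// lerD2l.
rewrite mulrDr -addrA lerD2l (mulrCA k) -[leRHS]mulrDr.
by rewrite ler_wpM2l// invr_ge0 ltW.
Qed.

Section time_grid.
Variables (R : realType) (t : nat -> R^o) (N : nat) (T : R).
Hypothesis grid : time_grid t N T.
Local Notation mu := (@lebesgue_measure R).

Lemma time_grid_le i j : (i <= j)%N -> (j <= N)%N -> t i <= t j.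
Proof.
have [_ tS _] := grid.
elim: j => [|j IH]; first by rewrite leqn0 => /eqP ->.
rewrite leq_eqVlt => /predU1P[->//|ij jN].
by rewrite (le_trans (IH ij (ltnW jN)))// ltW// tS.
Qed.

Lemma time_grid_itv i : (i <= N)%N -> 0 <= t i <= T.
Proof.
have [t0 _ tN] := grid => iN.
by rewrite -t0 -tN !time_grid_le.
Qed.

Lemma step_le_max i : (i < N)%N -> step t i <= step_max t N.
Proof.
move=> iN; rewrite /step_max; apply: le_bigmax_seq => //.
by rewrite mem_index_iota.
Qed.

(* Each step is covered by at most two of the overlapping windows
   ]t_(n-1), t_(n+1)[. *)
Lemma sum_window_integral_le (G : R -> R) : (1 < N)%N -> (forall x, 0 <= G x) ->
  mu.-integrable `]0, T[ (EFin \o G) ->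
  \sum_(1 <= n < N) \int[mu]_(s in `]t n.-1, t n.+1[) G s <=
    2 * \int[mu]_(s in `]0, T[) G s.
Proof.
move=> N1 G0 iG; have [t0 tS tN] := grid.
pose P (x : R) := \int[mu]_(s in `]0, x[) G s.
have PC (i j : nat) : (i < j)%N -> (j <= N)%N ->
    \int[mu]_(s in `]t i, t j[) G s <= P (t j) - P (t i).
  move=> ij jN; have /andP[i0 _] := time_grid_itv (leq_trans (ltnW ij) jN).
  have /andP[_ jT] := time_grid_itv jN.
  rewrite lerBrDl; apply: Rintegral_itv_oo_chain => //.
    by rewrite (lt_le_trans (tS _ (leq_trans ij jN)))// time_grid_le.
  by apply: integrableS iG => // x /=; rewrite !in_itv /= => /andP[-> /lt_le_trans ->].
have P0 x : 0 <= P x by apply: Rintegral_ge0.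
(* Splitting each window at its middle node produces two telescoping sums, each at most [P T]. *)
apply: (@le_trans _ _ (\sum_(1 <= n < N) ((P (t n.+1) - P (t n)) + (P (t n) - P (t n.-1))))).
  rewrite !big_nat; apply: ler_sum => -[//|n] /andP[_ nN] /=.
  by rewrite addrA subrK; apply: PC.
rewrite big_split /= telescope_sumr; last exact: ltnW.
rewrite (_ : \sum_(1 <= n < N) (P (t n) - P (t n.-1)) = P (t N.-1) - P (t 0%N)); last first.
  by case: N N1 => [//|n _]; rewrite big_add1 /= telescope_sumr.
have PN : P (t N.-1) <= P T.
  case: N N1 tN PC => [//|n] _ tN PC; rewrite -tN -subr_ge0 /=.
  by apply: le_trans (PC n n.+1 _ _) => //; exact: Rintegral_ge0.
have := P0 (t 1%N); have := P0 (t 0%N); move: PN; rewrite tN -/(P T).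
lra.
Qed.

End time_grid.

Lemma khat_bounds (R : realType) (theta : R) (t : nat -> R^o) m :
  0 <= theta <= 1 -> t m < t m.+1 -> t m.+1 < t m.+2 ->
  0 < khat theta t m.+1 <= t m.+2 - t m.
Proof.
suff H (x y z : R) : 0 <= theta <= 1 -> x < y -> y < z ->
    0 < 2^-1 * (theta + 1) * (z - y) - 2^-1 * (theta - 1) * (y - x) <= z - x.
  exact: H.
move=> /andP[t0 t1] xy yz.
have a0 : 0 < y - x by rewrite subr_gt0.
have b0 : 0 < z - y by rewrite subr_gt0.
have -> : z - x = (y - x) + (z - y) by ring.
move: (y - x) (z - y) a0 b0 => a b a0 b0.
by apply/andP; split; nra.
Qed.

(** [K] is the window length, and [I], [J] are the integrals over it of the dual norm of [ftt] and
    of its square. The fourth power arises as follows: the consistency error [B * K * I] has square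
    at most [B^2 K^3 J] by Cauchy-Schwarz, and the weight of the time sum adds one more [K]. *)
Lemma dln_step_estimate (R : realFieldType)
    (nu k K F I J B g dE l gD NL fw ft : R) :
  0 < nu -> 0 < k -> k <= K -> 0 <= F -> 0 <= I -> 0 <= B ->
  dE + l + k * (nu * g ^+ 2 + gD) + k * NL = k * fw -> I ^+ 2 <= K * J ->
  `|ft| <= F * g -> `|fw - ft| <= B * K * I * g ->
  dE + l + k * (nu / 2 * g ^+ 2 + gD) + k * NL <=
    nu^-1 * (K * F ^+ 2) + nu^-1 * (B ^+ 2 * K ^+ 4 * J).
Proof.
move=> nu0 k0 kK F0 I0 B0 id IJ ftF fwft.
have K0 : 0 < K by exact: lt_le_trans kK.
have E0 : 0 <= B * K * I by rewrite !mulr_ge0// ltW.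
have EQ : (B * K * I) ^+ 2 <= B ^+ 2 * K ^+ 3 * J.
  have -> : B ^+ 2 * K ^+ 3 * J = (B * K) ^+ 2 * (K * J) by ring.
  by rewrite exprMn ler_wpM2l ?sqr_ge0.
have bFE : fw <= (F + B * K * I) * g.
  move: ftF fwft; rewrite !ler_norml => /andP[_ ?] /andP[_ ?].
  by rewrite mulrDl; lra.
have kKb : 0 <= k <= K by rewrite ltW.
have := young_forcing nu0 kKb F0 E0 EQ bFE; rewrite -id.
have -> : K * (B ^+ 2 * K ^+ 3 * J) = B ^+ 2 * K ^+ 4 * J by ring.
(* One half of the viscous term cancels the half spent in Young's inequality; the other stays on the
   left. *)
have -> : k * (nu * g ^+ 2 + gD) = k * (nu / 2 * g ^+ 2) + k * (nu / 2 * g ^+ 2 + gD).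
  by field.
move: (k * (_ + _)) (k * (nu / 2 * _)) (nu^-1 * _) (nu^-1 * _) => a b c e; lra.
Qed.

Section dln_step.
Variables (R : realType) (theta : R) (d : nat) (Omega : set 'rV[R]_d).
Variables (nu mu Cs delta gamma : R).
Variables (Xh : set (field_grad R d)) (Qh : set ('rV[R]_d -> R^o)).
Variables (T : R) (t : nat -> R^o) (f ftt : R -> functional R d).
Variables (w : nat -> field_grad R d) (q : nat -> 'rV[R]_d -> R^o) (m : nat).
Hypothesis th : 0 <= theta <= 1.
Hypothesis mO : measurable (Omega : set (Rd R d)).
Hypothesis fO : (leb (Omega : set (Rd R d)) < +oo)%E.
Hypothesis nu0 : 0 < nu.
Hypothesis hX : findim_subspace Xh.
Hypothesis XhX : Xh `<=` spaceX Omega.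
Hypothesis hQ : findim_subspace Qh.
Hypothesis hf : body_force Omega T f ftt.
Hypotheses (t01 : t m < t m.+1) (t12 : t m.+1 < t m.+2).
Hypotheses (t00 : 0 <= t m) (t2T : t m.+2 <= T).
Hypothesis Xw : forall l, (l < 3)%N -> Xh (w (m + l)%N).
Hypothesis Qq : forall l, (l < 3)%N -> Qh (q (m + l)%N).
Hypothesis mom : dln_momentum Omega Xh theta nu mu Cs delta gamma t f w q m.+1.
Hypothesis con : dln_continuity Omega Qh theta t w m.+1.

Let kappa := Cs ^+ 4 * delta ^+ 2 / mu ^+ 2.
Let wb := beta_avg theta t w m.+1.
Let wl := stencil (dln_lambda theta (eps_ t m.+1)) w m.+1.

Lemma dln_energy_step :
  dln_energy Omega theta kappa (w m.+2) (w m.+1)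
  - dln_energy Omega theta kappa (w m.+1) (w m) + energy Omega kappa wl
  + khat theta t m.+1 * (nu / 2 * l2norm Omega wb.2 ^+ 2
                         + gamma * l2norm0 Omega (div wb) ^+ 2)
  + khat theta t m.+1 * \int[leb]_(x in (Omega : set (Rd R d)))
      ((Cs * delta) ^+ 2 * enorm (wb.2 x) * enorm (wb.2 x) ^+ 2)
  <= nu^-1 * ((step t m.+1 + step t m)
              * dual_norm Omega (f (beta_avg theta t t m.+1)) ^+ 2)
     + nu^-1 * (dln_beta_bound theta ^+ 2 * (step t m.+1 + step t m) ^+ 4
        * \int[@lebesgue_measure R]_(s in `]t m, t m.+2[)
            (dual_norm Omega (ftt s) ^+ 2)).
Proof.
have [df _ L2 _] := hf; have [dg _ _] := L2.
have [iG2 iG] := L2X'_dual_norm_integrable L2.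
have KE : step t m.+1 + step t m = t m.+2 - t m.
  suff H (x y z : R) : (z - y) + (y - x) = z - x by exact: H.
  by ring.
rewrite KE; have /andP[k0 kK] := khat_bounds th t01 t12.
have K0 : 0 < t m.+2 - t m by exact: lt_le_trans kK.
have sub : `]t m, t m.+2[%classic `<=` `]0, T[%classic.
  move=> x /=; rewrite !in_itv /= => /andP[x1 x2].
  by rewrite (le_lt_trans t00 x1) (lt_le_trans x2 t2T).
have Xwb : spaceX Omega wb.
  have [X0 XD _] := hX; apply: XhX.
  exact: (@stencil_closed _ _ Xh _ w m.+1 X0 XD Xw).
have iGS : (@lebesgue_measure R).-integrable `]t m, t m.+2[
    (EFin \o (fun s => dual_norm Omega (ftt s))).
  exact: integrableS iG.
have iG2S : (@lebesgue_measure R).-integrable `]t m, t m.+2[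
    (EFin \o (fun s => dual_norm Omega (ftt s) ^+ 2)).
  exact: integrableS iG2.
have dft : dualX Omega (f (beta_avg theta t t m.+1)).
  apply: df; rewrite /= in_itv /=; have /andP[h1 h2] := beta_avg_time_mem t01 t12 th.
  by rewrite (le_trans t00 h1) (le_trans h2 t2T).
have := dln_consistency hf th t01 t12 t00 t2T Xwb.
have := dual_norm_bound dft Xwb.
have := Rintegral_sqr_le (lt_trans t01 t12) iGS iG2S.
have I0 : 0 <= \int[@lebesgue_measure R]_(s in `]t m, t m.+2[)
    dual_norm Omega (ftt s).
  by apply: Rintegral_ge0 => s /sub sT; apply: dual_norm_ge0; exact: dg.
have := dln_energy_identity mO fO th hX XhX hQ (eps_itv t01 t12)
  (lt0r_neq0 k0) Xw Qq mom con.
rewrite -/kappa -/wb -/wl.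
have F0 := dual_norm_ge0 dft; have B0 := dln_beta_bound_gt0 th.
move=> id IJ ftF fwft.
exact: (dln_step_estimate nu0 k0 kK F0 I0 (ltW B0) id IJ ftF fwft).
Qed.

End dln_step.

Theorem theorem4p5 (R : realType) (theta : R) (htheta : 0 <= theta <= 1) :
  exists C : R, 0 < C /\
  forall (d : nat) (Omega : set 'rV[R]_d)
    (nu mu Cs delta gamma : R)
    (Xh : set (field_grad R d)) (Qh : set ('rV[R]_d -> R^o))
    (N : nat) (T : R) (t : nat -> R^o)
    (f ftt : R -> functional R d)
    (w : nat -> field_grad R d) (q : nat -> 'rV[R]_d -> R^o),
  (d = 2%N \/ d = 3%N) ->
  regular_domain Omega ->
  0 < nu -> 0 < mu -> 0 < Cs -> 0 < delta -> 0 < gamma ->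
  findim_subspace Xh -> Xh `<=` spaceX Omega ->
  findim_subspace Qh -> Qh `<=` spaceQ Omega ->
  (1 < N)%N -> time_grid t N T ->
  body_force Omega T f ftt ->
  (forall n, (n <= N)%N -> Xh (w n) /\ Qh (q n)) ->
  (forall n, (1 <= n <= N.-1)%N ->
     dln_momentum Omega Xh theta nu mu Cs delta gamma t f w q n /\
     dln_continuity Omega Qh theta t w n) ->
  let kappa := Cs ^+ 4 * delta ^+ 2 / mu ^+ 2 in
  let wb := beta_avg theta t w in
  let wl n := stencil (dln_lambda theta (eps_ t n)) w n in
  (1 + theta) / 4
    * (l2norm Omega (w N).1 ^+ 2 + kappa * l2norm Omega (w N).2 ^+ 2)
  + (1 - theta) / 4
    * (l2norm Omega (w N.-1).1 ^+ 2 + kappa * l2norm Omega (w N.-1).2 ^+ 2)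
  + \sum_(1 <= n < N)
      (l2norm Omega (wl n).1 ^+ 2 + kappa * l2norm Omega (wl n).2 ^+ 2)
  + \sum_(1 <= n < N) khat theta t n *
      (nu / 2 * l2norm Omega (wb n).2 ^+ 2
       + gamma * l2norm0 Omega (div (wb n)) ^+ 2)
  + \sum_(1 <= n < N) khat theta t n *
      \int[leb]_(x in (Omega : set (Rd R d)))
        ((Cs * delta) ^+ 2 * enorm ((wb n).2 x) * enorm ((wb n).2 x) ^+ 2)
  <= C * step_max t N ^+ 4 / nu * L2X'_norm Omega T ftt ^+ 2
     + 1 / nu * triple_norm Omega theta t N f ^+ 2
     + (1 + theta) / 4
       * (l2norm Omega (w 1%N).1 ^+ 2 + kappa * l2norm Omega (w 1%N).2 ^+ 2)
     + (1 - theta) / 4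
       * (l2norm Omega (w 0%N).1 ^+ 2 + kappa * l2norm Omega (w 0%N).2 ^+ 2).
Proof.
have B0 := dln_beta_bound_gt0 htheta.
(* 32 = 2^4 * 2: each window is at most twice the largest step, and enters to the fourth power; the
   overlap of the windows costs another factor 2. *)
exists (32 * dln_beta_bound theta ^+ 2); split; first by rewrite mulr_gt0// exprn_gt0.
move=> d Omega nu mu Cs delta gamma Xh Qh N T t f ftt w q _ [_ oO _ bO _].
move=> nu0 mu0 _ _ _ hX XhX hQ _ N1 grid hf Xw scheme; lazy zeta.
pose kappa := Cs ^+ 4 * delta ^+ 2 / mu ^+ 2.
pose wb := beta_avg theta t w.
pose wl n := stencil (dln_lambda theta (eps_ t n)) w n.
have mO := open_measurable_Rd oO; have fO := leb_bounded_lty bO.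
have [t0 tS tN] := grid.
pose J n := \int[@lebesgue_measure R]_(s in `]t n.-1, t n.+1[)
  (dual_norm Omega (ftt s) ^+ 2).
pose F n := (step t n + step t n.-1) * dual_norm Omega (f (beta_avg theta t t n)) ^+ 2.
pose E n := dln_energy Omega theta kappa (w n) (w n.-1).
pose l n := energy Omega kappa (wl n).
pose D n := khat theta t n * (nu / 2 * l2norm Omega (wb n).2 ^+ 2
       + gamma * l2norm0 Omega (div (wb n)) ^+ 2).
pose I n := khat theta t n *
      \int[leb]_(x in (Omega : set (Rd R d)))
        ((Cs * delta) ^+ 2 * enorm ((wb n).2 x) * enorm ((wb n).2 x) ^+ 2).
have J0 n : 0 <= J n by apply: Rintegral_ge0 => s _; rewrite sqr_ge0.
have stepn n : (1 <= n < N)%N -> E n.+1 - E n + l n + D n + I n <=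
    nu^-1 * F n
    + nu^-1 * (dln_beta_bound theta ^+ 2 * (2 * step_max t N) ^+ 4) * J n.
  case: n => [//|m] /= mN.
  have m2 : (m < N)%N by exact: ltn_trans mN.
  have /andP[m0 _] := time_grid_itv grid (ltnW m2).
  have /andP[_ mT] := time_grid_itv grid mN.
  have X3 i : (i < 3)%N -> (m + i <= N)%N.
    by move=> i3; apply: leq_trans mN; rewrite -addn2 leq_add2l.
  have [mom con] : dln_momentum Omega Xh theta nu mu Cs delta gamma t f w q m.+1 /\
      dln_continuity Omega Qh theta t w m.+1.
    by apply: scheme; case: (N) mN.
  have := dln_energy_step htheta mO fO nu0 hX XhX hQ hf (tS _ m2) (tS _ mN) m0 mT
    (fun i i3 => (Xw _ (X3 i i3)).1) (fun i i3 => (Xw _ (X3 i i3)).2) mom con.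
  move=> /le_trans; apply; rewrite lerD2l -[leRHS]mulrA.
  rewrite ler_wpM2l ?invr_ge0 ?(ltW nu0)// ler_wpM2r//.
    exact: (J0 m.+1).
  rewrite ler_wpM2l ?sqr_ge0//.
  have s1 := step_le_max t m2; have s2 := step_le_max t mN.
  have p1 : 0 <= step t m by rewrite subr_ge0 ltW// tS.
  have p2 : 0 <= step t m.+1 by rewrite subr_ge0 ltW// tS.
  rewrite ler_pXn2r ?nnegrE//; lra.
have sumE : \sum_(1 <= n < N) (E n.+1 - E n + l n + D n + I n) =
    E N - E 1%N + \sum_(1 <= n < N) l n + \sum_(1 <= n < N) D n
    + \sum_(1 <= n < N) I n.
  by do 3 rewrite big_split /=; rewrite telescope_sumr// ltnW.
have main : E N - E 1%N + \sum_(1 <= n < N) l n + \sum_(1 <= n < N) D n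
    + \sum_(1 <= n < N) I n <= nu^-1 * (\sum_(1 <= n < N) F n)
    + nu^-1 * (dln_beta_bound theta ^+ 2 * (2 * step_max t N) ^+ 4)
      * \sum_(1 <= n < N) J n.
  by rewrite -sumE !mulr_sumr -big_split; exact: ler_sum_nat.
have [iG2 _] : _ := L2X'_dual_norm_integrable (let: And4 _ _ h _ := hf in h).
have SJ : \sum_(1 <= n < N) J n <= 2 * L2X'_norm Omega T ftt ^+ 2.
  rewrite /L2X'_norm sqr_sqrtr.
    by apply: (sum_window_integral_le grid N1 _ iG2) => s; rewrite sqr_ge0.
  by apply: Rintegral_ge0 => s _; rewrite sqr_ge0.
have SF : triple_norm Omega theta t N f ^+ 2 = \sum_(1 <= n < N) F n.
  rewrite /triple_norm sqr_sqrtr// big_nat; apply: sumr_ge0 => -[//|n] /= nN.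
  rewrite mulr_ge0 ?sqr_ge0// addr_ge0// subr_ge0 ltW// tS//.
  by rewrite ltnW.
rewrite SF.
have kk : nu^-1 * (dln_beta_bound theta ^+ 2 * (2 * step_max t N) ^+ 4)
    * \sum_(1 <= n < N) J n <=
    32 * dln_beta_bound theta ^+ 2 * step_max t N ^+ 4 / nu
      * L2X'_norm Omega T ftt ^+ 2.
  have -> : 32 * dln_beta_bound theta ^+ 2 * step_max t N ^+ 4 / nu
      * L2X'_norm Omega T ftt ^+ 2 =
    nu^-1 * (dln_beta_bound theta ^+ 2 * (2 * step_max t N) ^+ 4)
    * (2 * L2X'_norm Omega T ftt ^+ 2) by ring.
  have X0 : 0 <= (2 * step_max t N) ^+ 4 by exact: exprn_even_ge0.
  apply: ler_wpM2l SJ; apply: mulr_ge0; first by rewrite invr_ge0 ltW.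
  by apply: mulr_ge0 X0; exact: sqr_ge0.
rewrite -[leRHS]addrA.
(* After regrouping, the goal is this inequality with the abbreviations unfolded, the two initial
   energy terms forming [E 1]. *)
suff : E N + \sum_(1 <= n < N) l n + \sum_(1 <= n < N) D n + \sum_(1 <= n < N) I n
    <= 32 * dln_beta_bound theta ^+ 2 * step_max t N ^+ 4 / nu
      * L2X'_norm Omega T ftt ^+ 2 + 1 / nu * (\sum_(1 <= n < N) F n) + E 1%N.
  exact.
move: main kk; rewrite div1r.
move: (\sum_(_ <= _ < _) l _) (\sum_(_ <= _ < _) D _) (\sum_(_ <= _ < _) I _).
move=> sl sD sI; move: (_ * \sum_(_ <= _ < _) J _) (_ * \sum_(_ <= _ < _) F _).
move: (E N) (E 1%N) (_ * L2X'_norm _ _ _ ^+ 2) => a b x y z; lra.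
Qed.
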